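(* Let $(U_n)_{n\geq 1}$ be a stationary sequence of random variables with values in $\mathbb{S}^{d-1}$, i.e. for every $k$ the sequences $(U_n)_{n\geq1}$ and $(U_{k+n})_{n\geq1}$ are identically distributed. Assume that, for every convex body $A$ of $\mathbb{R}^d$, the sequence $(U_n)_{n\geq1}$ almost surely $S$-rounds $A$. Then $(U_n)_{n\geq1}$ is almost surely universal. The same conclusion holds when the $S$-rounding hypothesis is replaced with the $M$-rounding one, i.e. when one assumes instead that, for every convex body $A$, $(U_n)_{n\geq1}$ almost surely $M$-rounds $A$.
   Context: Let $d$ be a positive integer, $\mathbb{S}^{d-1}$ the Euclidean unit sphere of $\mathbb{R}^d$, $D$ the closed unit ball centered at the origin, and $\mathcal{K}_d$ the set of convex bodies of $\mathbb{R}^d$ (convex compact sets with nonempty interior), endowed with the Hausdorff distance $d_H$; all convergences of sets are for $d_H$. Steiner symmetrization: for $A\in\mathcal{K}_d$ and $u\in\mathbb{S}^{d-1}$, view $A$ as a family of line segments parallel to $u$; $S_uA$ is the set obtained by sliding each of these segments along $u$ so that its midpoint lies in $u^\perp$. Minkowski symmetrization: $B_uA=\frac12(A\oplus\pi_u(A))$, where $\pi_u$ is the orthogonal reflection with respect to $u^\perp$ and $\oplus$ is the Minkowski sum. The support function of $A$ is $f_A(\theta)=\sup_{x\in A}\langle x,\theta\rangle$, and the mean radius is $L(A)=\int_{\mathbb{S}^{d-1}}f_A\,d\sigma$, with $\sigma$ the rotation-invariant probability measure on $\mathbb{S}^{d-1}$. The number $r(A)>0$ is such that $r(A)D$ has the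 same volume as $A$. For a sequence $(u_n)_{n\geq1}$ in $\mathbb{S}^{d-1}$ and $n\geq k\geq1$ put $S_{k,n}A=S_{u_n}(\ldots S_{u_{k+1}}(S_{u_k}A)\ldots)$, $B_{k,n}A=B_{u_n}(\ldots B_{u_{k+1}}(B_{u_k}A)\ldots)$, $S_nA=S_{1,n}A$, $B_nA=B_{1,n}A$. The sequence $S$-rounds $A$ if $S_nA\to r(A)D$, and $M$-rounds $A$ if $B_nA\to L(A)D$, as $n\to\infty$. It is $S$-universal if for every $A\in\mathcal{K}_d$ and every $k\geq1$, $S_{k,n}A\to r(A)D$ as $n\to\infty$; it is $M$-universal if for every $A\in\mathcal{K}_d$ and every $k\geq1$, $B_{k,n}A\to L(A)D$ as $n\to\infty$. These two notions coincide, and a sequence satisfying them is called universal (i.e. it is both $S$-universal and $M$-universal). *)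

(* Defs.v *)
From HB Require Import structures.
From mathcomp Require Import all_boot all_order all_algebra.
From mathcomp Require Import all_classical all_reals all_analysis.
Import Order.TTheory GRing.Theory Num.Theory.
Import numFieldNormedType.Exports.

Set Implicit Arguments.
Unset Strict Implicit.
Unset Printing Implicit Defensive.

Local Open Scope classical_set_scope.
Local Open Scope ring_scope.

(** The norm carried by ['rV[R]_d] in the library is the sup norm, so the
    Euclidean structure is spelled out; the topology is the same. *)

Definition dot (R : realType) (d : nat) (x y : 'rV[R]_d) : R :=
  (x *m y^T) 0 0.

Definition enorm (R : realType) (d : nat) (x : 'rV[R]_d) : R :=
  Num.sqrt (dot x x).

Definition sphere (R : realType) (d : nat) : set 'rV[R]_d :=
  [set x | enorm x = 1].

Definition unit_ball (R : realType) (d : nat) : set 'rV[R]_d :=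
  [set x | enorm x <= 1].

Arguments sphere : clear implicits.
Arguments unit_ball : clear implicits.

Definition dilate (R : realType) (d : nat) (r : R) (A : set 'rV[R]_d) :
    set 'rV[R]_d :=
  [set r *: x | x in A].

Definition convex_body (R : realType) (d : nat) (A : set 'rV[R]_d) : Prop :=
  [/\ convex_set A, compact A & A° !=set0].

(** [sup] and [inf] are real-valued: this is the Hausdorff distance on nonempty
    bounded sets only. *)
Definition hausdorff_dist (R : realType) (d : nat) (A B : set 'rV[R]_d) : R :=
  Num.max (sup [set inf [set enorm (a - b) | b in B] | a in A])
          (sup [set inf [set enorm (a - b) | a in A] | b in B]).

Definition hausdorff_cvg (R : realType) (d : nat)
    (K : nat -> set 'rV[R]_d) (B : set 'rV[R]_d) : Prop :=
  hausdorff_dist (K n) B @[n --> \oo] --> (0 : R).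

(** Lebesgue measure on R^d as an iterated product measure: the step is
    [product_measure1 lebesgue_measure (volume n)], unfolded, with R^(n+1)
    split as R * R^n. *)
Fixpoint volume (R : realType) (n : nat) : set 'rV[R]_n -> \bar R :=
  match n with
  | 0 => fun A => (\1_A (0 : 'rV[R]_0))%:E
  | m.+1 => fun A =>
      (\int[@lebesgue_measure R]_x
         volume [set y : 'rV[R]_m | A (row_mx (x%:M : 'M[R]_1) y)])%E
  end.

(** For a convex body and [0 < d] there is exactly one such [r], so that the
    default value of [get] plays no role. *)
Definition volume_radius (R : realType) (d : nat) (A : set 'rV[R]_d) : R :=
  get [set r | 0 < r /\ volume (dilate r (unit_ball R d)) = volume A].

(** Coordinates along [u] of the points of the chord of [A] through [a]
    parallel to [u]. *)
Definition chord (R : realType) (d : nat) (u : 'rV[R]_d) (A : set 'rV[R]_d)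
    (a : 'rV[R]_d) : set R :=
  [set dot (a + t *: u) u | t in [set t | A (a + t *: u)]].

Definition chord_midpoint (R : realType) (d : nat) (u : 'rV[R]_d)
    (A : set 'rV[R]_d) (a : 'rV[R]_d) : R :=
  (inf (chord u A a) + sup (chord u A a)) / 2.

(** Every point [a] is moved with its chord, by the translation along [u]
    bringing the midpoint of that chord to the hyperplane orthogonal to [u]. *)
Definition steiner_sym (R : realType) (d : nat) (u : 'rV[R]_d)
    (A : set 'rV[R]_d) : set 'rV[R]_d :=
  [set a - chord_midpoint u A a *: u | a in A].

Definition reflection (R : realType) (d : nat) (u x : 'rV[R]_d) : 'rV[R]_d :=
  x - (2 * dot x u) *: u.

Definition minkowski_sum (R : realType) (d : nat) (A B : set 'rV[R]_d) :
    set 'rV[R]_d :=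
  [set x + y | x in A & y in B].

Definition minkowski_sym (R : realType) (d : nat) (u : 'rV[R]_d)
    (A : set 'rV[R]_d) : set 'rV[R]_d :=
  dilate 2^-1 (minkowski_sum A (reflection u @` A)).

Definition support_fun (R : realType) (d : nat) (A : set 'rV[R]_d)
    (theta : 'rV[R]_d) : R :=
  sup [set dot x theta | x in A].

Notation borel_rV R d := (g_sigma_algebraType (@open 'rV[R]_d)).

(** Measures on the sphere are seen as measures on the ambient space that are
    carried by the sphere.  Invariance is under the whole orthogonal group,
    which is what singles out the uniform measure on {-1, 1} when [d = 1]. *)
Definition rotation_invariant (R : realType) (d : nat)
    (sigma : probability (borel_rV R d) R) : Prop :=
  sigma (sphere R d) = 1%E /\
  forall (Q : 'M[R]_d) (E : set (borel_rV R d)),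
    Q *m Q^T = 1%:M -> measurable E ->
    sigma [set x : 'rV[R]_d | E (x *m Q)] = sigma E.

Definition mean_radius (R : realType) (d : nat)
    (sigma : probability (borel_rV R d) R) (A : set 'rV[R]_d) : R :=
  Rintegral sigma (sphere R d) (support_fun A).

(** Sequences (u_n)_(n >= 1) are indexed from 0: [u i] stands for u_(i+1).
    Hence [iter_sym T u k n A] is T_(u_n) (... (T_(u_(k+1)) A) ...), that is
    T_(k+1,n) A, and the case [k = 0] is T_n A. *)
Definition iter_sym (R : realType) (d : nat)
    (T : 'rV[R]_d -> set 'rV[R]_d -> set 'rV[R]_d)
    (u : nat -> 'rV[R]_d) (k n : nat) (A : set 'rV[R]_d) : set 'rV[R]_d :=
  foldl (fun B i => T (u i) B) A (index_iota k n).

Definition S_rounds (R : realType) (d : nat) (u : nat -> 'rV[R]_d)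
    (A : set 'rV[R]_d) : Prop :=
  hausdorff_cvg (fun n => iter_sym (@steiner_sym R d) u 0 n A)
    (dilate (volume_radius A) (unit_ball R d)).

Definition M_rounds (R : realType) (d : nat)
    (sigma : probability (borel_rV R d) R) (u : nat -> 'rV[R]_d)
    (A : set 'rV[R]_d) : Prop :=
  hausdorff_cvg (fun n => iter_sym (@minkowski_sym R d) u 0 n A)
    (dilate (mean_radius sigma A) (unit_ball R d)).

Definition S_universal (R : realType) (d : nat) (u : nat -> 'rV[R]_d) : Prop :=
  forall (A : set 'rV[R]_d) (k : nat), convex_body A ->
    hausdorff_cvg (fun n => iter_sym (@steiner_sym R d) u k n A)
      (dilate (volume_radius A) (unit_ball R d)).

Definition M_universal (R : realType) (d : nat)
    (sigma : probability (borel_rV R d) R) (u : nat -> 'rV[R]_d) : Prop :=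
  forall (A : set 'rV[R]_d) (k : nat), convex_body A ->
    hausdorff_cvg (fun n => iter_sym (@minkowski_sym R d) u k n A)
      (dilate (mean_radius sigma A) (unit_ball R d)).

Definition universal (R : realType) (d : nat)
    (sigma : probability (borel_rV R d) R) (u : nat -> 'rV[R]_d) : Prop :=
  S_universal u /\ M_universal sigma u.

(** Product sigma-algebra on the space of sequences; two sequences of random
    variables are identically distributed when their laws agree on it. *)
Definition seq_measurable (disp : measure_display) (T : measurableType disp) :
    set (set (nat -> T)) :=
  <<s \bigcup_n preimage_set_system [set: nat -> T] (fun x => x n) measurable >>.

Definition stationary (disp disp' : measure_display)
    (Omega : measurableType disp) (T : measurableType disp') (R : realType)
    (P : probability Omega R) (X : nat -> {RV P >-> T}) : Prop :=
  forall (k : nat) (E : set (nat -> T)), seq_measurable E ->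
    P [set w | E (fun n => X n w)] = P [set w | E (fun n => X (k + n)%N w)].

(* Main.v *)
(** For a unit vector [u], both symmetrals of a convex body [A] consist of the
    points [(x + refl_u y) / 2] with [x, y] in [A]; for the Steiner symmetral
    one asks moreover that [x - y] be parallel to [u].  Hence [S_u A] is
    contained in [B_u A], both operations are monotone in [A], and both depend
    on [(u, A)] in an upper semicontinuous way, so that the rounding events are
    measurable.  By stationarity, almost surely every shift of the sequence
    rounds every member of a countable family of bodies that approximates all
    bodies from outside; by monotonicity the symmetrals of an arbitrary body
    are then eventually contained in balls only slightly larger than the
    expected one.  A body contained in such a ball and having the same volume
    (or the same mean radius) as the expected ball is close to it, and [S]
    preserves the volume while [B] preserves the mean radius.  Finally, the
    inclusion of [S_u A] in [B_u A], applied from a late time on, shows that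
    each form of universality implies the other. *)
From HB Require Import structures.
Require Import Defs.
From mathcomp Require Import all_boot all_order all_algebra.
From mathcomp Require Import finmap.
From mathcomp Require Import all_classical all_reals all_analysis.
From mathcomp Require Import measurable_realfun ring lra.
Import Order.TTheory GRing.Theory Num.Theory.
Import numFieldNormedType.Exports.

Local Open Scope classical_set_scope.
Local Open Scope ring_scope.

Set Implicit Arguments.
Unset Strict Implicit.
Unset Printing Implicit Defensive.

(** * Euclidean geometry *)

(** The hypothesis gives one null set per body, whereas universality wants a single one for
    uncountably many bodies. Closeness for the Hausdorff distance cannot bridge this gap: Steiner
    symmetrization may drive close bodies apart, thin ones near a segment for instance, and nothing
    would control the defect along the iteration. Inclusion, in contrast, survives any number of
    steps. The same one-sidedness decides how rounding events are written: lying in an open ball is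
    an open condition on finitely many directions, and so is the failure of the lower bound, which
    means lying in an open half-space. Upper semicontinuity therefore handles both sides. All
    estimates are made on support functions, where convergence to a centred ball is uniform
    convergence to a constant on the sphere. Volume is defined coordinate by coordinate; its
    conservation by [S_u] for a slanted [u] comes from Cavalieri's principle along the axes, carried
    to other directions by shears. *)

Section Euclidean.
Context {R : realType} {d : nat}.
Implicit Types (x y z u v : 'rV[R]_d) (a b : R).

Lemma dotE x y : dot x y = \sum_i x 0 i * y 0 i.
Proof. by rewrite /dot mxE; apply: eq_bigr => i _; rewrite mxE. Qed.

Lemma dotC x y : dot x y = dot y x.
Proof. by rewrite !dotE; apply: eq_bigr => i _; rewrite mulrC. Qed.

Lemma dotDl x y z : dot (x + y) z = dot x z + dot y z.
Proof. by rewrite /dot mulmxDl mxE. Qed.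

Lemma dotZl a x y : dot (a *: x) y = a * dot x y.
Proof. by rewrite /dot -scalemxAl mxE. Qed.

Lemma dotNl x y : dot (- x) y = - dot x y.
Proof. by rewrite /dot mulNmx mxE. Qed.

Lemma dotDr x y z : dot x (y + z) = dot x y + dot x z.
Proof. by rewrite dotC dotDl !(dotC x). Qed.

Lemma dotZr a x y : dot x (a *: y) = a * dot x y.
Proof. by rewrite dotC dotZl (dotC x). Qed.

Lemma dotNr x y : dot x (- y) = - dot x y.
Proof. by rewrite dotC dotNl (dotC x). Qed.

Lemma dot0l x : dot 0 x = 0.
Proof. by rewrite /dot mul0mx mxE. Qed.

Lemma dot0r x : dot x 0 = 0.
Proof. by rewrite dotC dot0l. Qed.

Definition dotL := (dotDl, dotDr, dotZl, dotZr, dotNl, dotNr, dot0l, dot0r).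

Lemma dot_ge0 x : 0 <= dot x x.
Proof. by rewrite dotE sumr_ge0// => i _; rewrite -expr2 sqr_ge0. Qed.

Lemma dot_eq0 x : dot x x = 0 -> x = 0.
Proof.
rewrite dotE => /eqP; rewrite psumr_eq0 => [/allP x0|i _]; last first.
  by rewrite -expr2 sqr_ge0.
apply/rowP => i; rewrite mxE; apply/eqP.
by have := x0 i (mem_index_enum _); rewrite -expr2 sqrf_eq0.
Qed.

Lemma enorm_ge0 x : 0 <= enorm x.
Proof. exact: sqrtr_ge0. Qed.

Lemma enorm_sqr x : enorm x ^+ 2 = dot x x.
Proof. by rewrite sqr_sqrtr// dot_ge0. Qed.

Lemma enorm0 : enorm (0 : 'rV[R]_d) = 0.
Proof. by rewrite /enorm dot0l sqrtr0. Qed.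

Lemma enorm_eq0 x : enorm x = 0 -> x = 0.
Proof. by move=> x0; apply: dot_eq0; rewrite -enorm_sqr x0 expr0n. Qed.

Lemma enormZ a x : enorm (a *: x) = `|a| * enorm x.
Proof.
by rewrite /enorm !dotL mulrA -expr2 sqrtrM ?sqr_ge0// sqrtr_sqr.
Qed.

Lemma enormN x : enorm (- x) = enorm x.
Proof. by rewrite /enorm !dotL opprK. Qed.

Lemma enormBC x y : enorm (x - y) = enorm (y - x).
Proof. by rewrite -enormN opprB. Qed.

Lemma enorm_gt0 x : x != 0 -> 0 < enorm x.
Proof.
move=> x0; rewrite lt_neqAle enorm_ge0 andbT eq_sym.
by apply: contra_neq x0 => /enorm_eq0.
Qed.

Lemma dot_le x y : dot x y <= enorm x * enorm y.
Proof.
have [->|y0] := eqVneq y 0; first by rewrite dot0r enorm0 mulr0.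
have [->|x0] := eqVneq x 0; first by rewrite dot0l enorm0 mul0r.
have := dot_ge0 (enorm y *: x - enorm x *: y).
rewrite !dotL -!enorm_sqr (dotC y x) => H.
have p := mulr_gt0 (enorm_gt0 x0) (enorm_gt0 y0).
rewrite -(ler_pM2l p); lra.
Qed.

Lemma dot_abs x y : `|dot x y| <= enorm x * enorm y.
Proof.
by rewrite ler_norml dot_le andbT lerNl -dotNl -(enormN x) dot_le.
Qed.

Lemma enormD x y : enorm (x + y) <= enorm x + enorm y.
Proof.
rewrite -(@ler_pXn2r _ 2) ?nnegrE ?addr_ge0 ?enorm_ge0// enorm_sqr !dotL.
rewrite -!enorm_sqr (dotC y x); have := dot_le x y; nra.
Qed.

Lemma enormB x y : enorm (x - y) <= enorm x + enorm y.
Proof. by rewrite -(enormN y) enormD. Qed.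

Lemma enorm_distD x y z : enorm (x - z) <= enorm (x - y) + enorm (y - z).
Proof. by apply: le_trans (enormD _ _); rewrite addrA subrK. Qed.

Lemma norm_entry x i : `|x 0 i| <= `|x|.
Proof.
rewrite [leRHS]/Num.norm /= mx_normrE; apply/bigmax_geP; right => /=.
by exists (0, i).
Qed.

Lemma norm_leP x a : 0 <= a -> (forall i, `|x 0 i| <= a) -> `|x| <= a.
Proof.
move=> a0 H; rewrite [leLHS]/Num.norm /= mx_normrE; apply/bigmax_leP.
by split => // -[i j] _ /=; rewrite (ord1 i).
Qed.

Lemma norm_le_enorm x : `|x| <= enorm x.
Proof.
apply: norm_leP (enorm_ge0 _) _ => i.
rewrite -(@ler_pXn2r _ 2) ?nnegrE ?enorm_ge0// enorm_sqr dotE.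
rewrite real_normK ?num_real// (bigD1 i)//= -expr2 lerDl sumr_ge0// => j _.
by rewrite -expr2 sqr_ge0.
Qed.

Lemma enorm_le_norm x : enorm x <= (d%:R + 1) * `|x|.
Proof.
rewrite -(@ler_pXn2r _ 2) ?nnegrE ?mulr_ge0 ?enorm_ge0 ?addr_ge0//.
rewrite enorm_sqr dotE exprMn.
apply: (@le_trans _ _ (\sum_(i < d) `|x| ^+ 2)).
  apply: ler_sum => i _; rewrite -expr2 -real_normK ?num_real//.
  by rewrite ler_pXn2r ?nnegrE// norm_entry.
rewrite sumr_const card_ord -[leLHS]mulr_natl ler_wpM2r ?sqr_ge0//.
by have := ler0n R d; nra.
Qed.

Lemma dist_abs_enorm x y : `|enorm x - enorm y| <= enorm (x - y).
Proof.
have := enormD (x - y) y; have := enormD (y - x) x.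
rewrite !subrK (enormBC y) ler_norml; lra.
Qed.

Lemma enorm_lt_nbhs x e : 0 < e -> \forall y \near x, enorm (x - y) < e.
Proof.
move=> e0; have D0 : 0 < (d%:R + 1 : R) by rewrite ltr_wpDl.
have : nbhs x (ball x (e / (d%:R + 1))) by apply: nbhsx_ballx; rewrite divr_gt0.
apply: filterS => y; rewrite -ball_normE /= => xy.
apply: le_lt_trans (enorm_le_norm _) _.
by rewrite mulrC -ltr_pdivlMr.
Qed.

Lemma nbhs_enormP x (V : set 'rV[R]_d) :
  nbhs x V <-> exists2 e, 0 < e & forall y, enorm (x - y) < e -> V y.
Proof.
split=> [/nbhs_ballP[e /= e0 eV]|[e e0 eV]].
  exists e => // y xy; apply: eV; rewrite -ball_normE /=.
  exact: le_lt_trans (norm_le_enorm _) xy.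
by have := enorm_lt_nbhs x e0; apply: filterS => y; exact: eV.
Qed.

Lemma enorm_continuous : continuous (@enorm R d).
Proof.
move=> x; apply/(@cvgrPdist_lt _ _ _ (nbhs x)) => e e0.
near=> y; apply: le_lt_trans (dist_abs_enorm _ _) _; near: y.
exact: enorm_lt_nbhs.
Unshelve. all: by end_near. Qed.

Lemma dotr_continuous y : continuous (fun x => dot x y).
Proof.
move=> x; apply/(@cvgrPdist_lt _ _ _ (nbhs x)) => e e0.
have D0 : 0 < enorm y + 1 by rewrite ltr_wpDl ?enorm_ge0.
near=> z; have xz : enorm (x - z) < e / (enorm y + 1).
  by near: z; apply: enorm_lt_nbhs; rewrite divr_gt0.
rewrite -dotNl -dotDl (le_lt_trans (dot_abs _ _))//.
apply: (@le_lt_trans _ _ (enorm (x - z) * (enorm y + 1))).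
  by rewrite ler_wpM2l ?enorm_ge0// lerDl.
by rewrite -ltr_pdivlMr.
Unshelve. all: by end_near. Qed.

Lemma dot_cvg (T : Type) (F : set_system T) (f g : T -> 'rV[R]_d) x y :
  Filter F -> f @ F --> x -> g @ F --> y ->
  dot (f t) (g t) @[t --> F] --> dot x y.
Proof.
move=> FF fx gy; under eq_fun do rewrite dotE.
rewrite dotE; apply: cvg_big => [|i _]; first exact: add_continuous.
apply: cvgM.
  have := @coord_continuous R 1 d 0 i x; exact: cvg_comp.
by have := @coord_continuous R 1 d 0 i y; exact: cvg_comp.
Qed.

Lemma reflectionD u x y :
  reflection u (x + y) = reflection u x + reflection u y.
Proof. by apply/rowP => i; rewrite /reflection !dotL !mxE; ring. Qed.

Lemma reflectionZ u a x : reflection u (a *: x) = a *: reflection u x.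
Proof. by apply/rowP => i; rewrite /reflection !dotL !mxE; ring. Qed.

Lemma reflectionN u x : reflection u (- x) = - reflection u x.
Proof. by rewrite -scaleN1r reflectionZ scaleN1r. Qed.

Lemma dot_reflection u x y : dot (reflection u x) y = dot x (reflection u y).
Proof. by rewrite /reflection !dotL (dotC y u); ring. Qed.

Lemma sphereP u : sphere R d u -> dot u u = 1.
Proof. by rewrite /sphere /= => u1; rewrite -enorm_sqr u1 expr1n. Qed.

Lemma reflectionK u : sphere R d u -> involutive (reflection u).
Proof.
by move=> /sphereP u1 x; apply/rowP => i; rewrite /reflection !dotL u1 !mxE; ring.
Qed.

Lemma enorm_reflection u x : sphere R d u -> enorm (reflection u x) = enorm x.
Proof. by move=> u1; rewrite /enorm dot_reflection reflectionK. Qed.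

Lemma enorm_normalized x : x != 0 -> enorm ((enorm x)^-1 *: x) = 1.
Proof.
move=> x0; rewrite enormZ normfV ger0_norm ?enorm_ge0// mulVf//.
by rewrite gt_eqF// enorm_gt0.
Qed.

(** [rotation_invariant] speaks of right multiplication by orthogonal matrices; this puts
    reflections in that form. *)
Definition reflection_mx u : 'M[R]_d := 1%:M - 2 *: (u^T *m u).

Lemma mul_reflection_mx u x : x *m reflection_mx u = reflection u x.
Proof.
rewrite /reflection_mx mulmxBr mulmx1 -scalemxAr mulmxA.
by rewrite [x *m u^T]mx11_scalar -/(dot x u) mul_scalar_mx scalerA.
Qed.

Lemma reflection_mx_orth u : sphere R d u ->
  reflection_mx u *m (reflection_mx u)^T = 1%:M.
Proof.
move=> u1.
have -> : (reflection_mx u)^T = reflection_mx u.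
  by rewrite /reflection_mx linearB /= linearZ /= trmx_mul trmxK trmx1.
by apply/row_matrixP => i; rewrite !rowE mulmxA !mul_reflection_mx reflectionK ?mulmx1.
Qed.

(** The mirror is the hyperplane bisecting [x] and [y]. Distinctness matters: in dimension 1 the
    only reflection exchanges the two points of the sphere. *)
Lemma reflection_transitive x y : sphere R d x -> sphere R d y ->
  x != y -> exists2 u, sphere R d u & reflection u x = y.
Proof.
move=> x1 y1; rewrite -subr_eq0 => xy.
exists ((enorm (x - y))^-1 *: (x - y)); first exact: enorm_normalized.
have n0 := enorm_gt0 xy.
have E : dot x (x - y) = enorm (x - y) ^+ 2 / 2.
  by rewrite enorm_sqr !dotL (dotC y x) !sphereP//; field.
rewrite /reflection dotZr E scalerA.
suff -> : 2 * ((enorm (x - y))^-1 * (enorm (x - y) ^+ 2 / 2)) / enorm (x - y) = 1.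
  by rewrite scale1r opprB addrC subrK.
by field; rewrite gt_eqF.
Qed.

End Euclidean.

(** * Convex bodies and support functions *)

Section Bodies.
Context {R : realType} {d : nat}.
Implicit Types (x y z u v : 'rV[R]_d) (a b r : R) (A B K : set 'rV[R]_d).

Definition cvx A := forall x y t, A x -> A y -> 0 <= t <= 1 ->
  A (t *: x + (1 - t) *: y).

Definition cball x r := [set y | enorm (y - x) <= r].

(** The interior point comes with a Euclidean ball because symmetrization keeps the radius of an
    inscribed ball ([psym_cball]). *)
Definition body A :=
  [/\ cvx A, compact A & exists c r, 0 < r /\ cball c r `<=` A].

Lemma convex_bodyP A : convex_body A <-> body A.
Proof.
have cvxP : convex_set A <-> cvx A.
  split=> [cA x y t Ax Ay /andP[t0 t1]|cA x y t].
    have t01 : Itv.spec (@Itv.num_sem R) (Itv.Real `[0%Z, 1%Z]) t.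
      by rewrite /= /Itv.num_sem /= num_real in_itv /= t0 t1.
    have := cA x y (Itv.mk t01); rewrite !inE => /(_ Ax Ay).
    by congr A.
  rewrite !inE => Ax Ay; apply: cA => //.
  exact/andP.
have intP : A° !=set0 <-> exists c r, 0 < r /\ cball c r `<=` A.
  split=> [[c /nbhs_enormP[e e0 eA]]|[c [r [r0 rA]]]].
    exists c, (e / 2); split=> [|y]; first exact: divr_gt0.
    by rewrite /cball /= => cy; apply: eA; rewrite enormBC; lra.
  exists c; apply/nbhs_enormP; exists r => // y cy; apply: rA.
  by rewrite /cball /= enormBC ltW.
by split=> -[] /cvxP cA kA /intP iA; split.
Qed.

Lemma rV_closed A : compact A -> closed A.
Proof. by apply: compact_closed; exact: norm_hausdorff. Qed.

Lemma compact_enorm A : compact A -> exists2 M, 0 < M & forall x, A x -> enorm x <= M.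
Proof.
move=> /compact_bounded [M [_ MA]].
have M1 : M < `|M| + 1 by rewrite ltr_pwDr// ler_norm.
exists ((d%:R + 1) * (`|M| + 1)); first by rewrite mulr_gt0 ?ltr_wpDl.
move=> x Ax; apply: le_trans (enorm_le_norm _) _.
by rewrite ler_wpM2l ?addr_ge0// (MA _ M1).
Qed.

Lemma bounded_enorm A M : (forall x, A x -> enorm x <= M) -> bounded_set A.
Proof.
move=> AM; exists M; split; first exact: num_real.
move=> N MN x /AM xM; apply: le_trans (norm_le_enorm _) _.
exact: le_trans xM (ltW MN).
Qed.

Lemma edist_continuous x : continuous (fun y => enorm (y - x)).
Proof.
move=> y; apply/(@cvgrPdist_lt _ _ _ (nbhs y)) => e e0.
near=> z; apply: le_lt_trans (dist_abs_enorm _ _) _.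
rewrite opprB addrA subrK; near: z; exact: enorm_lt_nbhs.
Unshelve. all: by end_near. Qed.

Lemma cball_closed x r : closed (cball x r).
Proof.
apply: (@preimage_closed _ _ (fun y => enorm (y - x)) [set t | t <= r]) => [y _|].
  exact: edist_continuous.
exact: closed_le.
Qed.

Lemma cball_compact x r : compact (cball x r).
Proof.
apply: bounded_closed_compact; last exact: cball_closed.
apply: (@bounded_enorm _ (r + enorm x)) => y; rewrite /cball /= => xy.
by have := enormD (y - x) x; rewrite subrK; lra.
Qed.

Lemma cball_cvx x r : cvx (cball x r).
Proof.
move=> y z t; rewrite /cball /= => yr zr /andP[t0 t1].
have -> : t *: y + (1 - t) *: z - x = t *: (y - x) + (1 - t) *: (z - x).
  by apply/rowP => i; rewrite !mxE; ring.
have t1' : 0 <= 1 - t by rewrite subr_ge0.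
apply: le_trans (enormD _ _) _; rewrite !enormZ !ger0_norm//; nra.
Qed.

(** The degenerate radius [0] is covered because the mean radius is only shown to be nonnegative. *)
Lemma dilate_unit_ball r : 0 <= r -> dilate r (unit_ball R d) = cball 0 r.
Proof.
rewrite le_eqVlt => /orP[/eqP <-|r0]; apply/seteqP; split=> x /=.
- move=> [y _ <-]; rewrite /cball /= scale0r subr0 enorm0//.
- rewrite /cball /= subr0 => x0; exists 0; first by rewrite /unit_ball /= enorm0.
  by rewrite scaler0; apply/esym/enorm_eq0/eqP; rewrite eq_le x0 enorm_ge0.
- move=> [y]; rewrite /unit_ball /cball /= => y1 <-.
  by rewrite subr0 enormZ gtr0_norm// ler_piMr// ltW.
- rewrite /cball /= subr0 => xr; exists (r^-1 *: x).
    by rewrite /unit_ball /= enormZ normfV gtr0_norm// mulrC ler_pdivrMr// mul1r.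
  by rewrite scalerA divff ?scale1r ?gt_eqF.
Qed.

Lemma body_cball x r : 0 < r -> body (cball x r).
Proof.
move=> r0; split; [exact: cball_cvx|exact: cball_compact|].
by exists x, r; split => // y.
Qed.

Lemma body_nonempty A : body A -> A !=set0.
Proof.
move=> [_ _ [c [r [r0 rA]]]]; exists c; apply: rA.
by rewrite /cball /= subrr enorm0 ltW.
Qed.

Lemma max_dot A x : A !=set0 -> compact A ->
  exists2 y, A y & forall z, A z -> dot z x <= dot y x.
Proof.
move=> A0 cA; have := @EVT_max_rV R d (fun z => dot z x) A A0 cA.
case=> [|y]; first by apply: continuous_subspaceT; exact: dotr_continuous.
by rewrite inE => Ay yA; exists y => // z Az; apply: yA; rewrite inE.
Qed.

Lemma support_fun_max A x y : A y -> (forall z, A z -> dot z x <= dot y x) ->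
  support_fun A x = dot y x.
Proof.
move=> Ay yA; apply/eqP; rewrite eq_le; apply/andP; split.
  apply: ge_sup; first by exists (dot y x), y.
  by move=> _ [z Az <-]; exact: yA.
apply: ub_le_sup; last by exists y.
by exists (dot y x) => _ [z Az <-]; exact: yA.
Qed.

Lemma support_funP A x : A !=set0 -> compact A ->
  exists2 y, A y & support_fun A x = dot y x.
Proof.
move=> A0 cA; have [y Ay yA] := max_dot x A0 cA; exists y => //.
exact: support_fun_max.
Qed.

Lemma support_fun_ge A x y : compact A -> A y -> dot y x <= support_fun A x.
Proof.
move=> cA Ay; have [z Az zA] := max_dot x (ex_intro _ y Ay) cA.
by rewrite (support_fun_max Az zA) zA.
Qed.

Lemma support_fun_mono A B x : A !=set0 -> compact A -> compact B ->
  A `<=` B -> support_fun A x <= support_fun B x.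
Proof.
move=> A0 cA cB AB; have [y Ay ->] := support_funP x A0 cA.
by apply: support_fun_ge => //; exact: AB.
Qed.

Lemma support_fun_cball x r : 0 <= r -> sphere R d x ->
  support_fun (cball 0 r) x = r.
Proof.
move=> r0 x1; rewrite (@support_fun_max _ _ (r *: x)).
- by rewrite dotZl sphereP// mulr1.
- by rewrite /cball /= subr0 enormZ (_ : enorm x = 1)// mulr1 ger0_norm.
- move=> z; rewrite /cball /= subr0 dotZl sphereP// mulr1 => zr.
  by rewrite (le_trans (dot_le _ _))// (_ : enorm x = 1)// mulr1.
Qed.

Lemma support_fun_le_cball A r x : A !=set0 -> compact A -> A `<=` cball 0 r ->
  sphere R d x -> support_fun A x <= r.
Proof.
move=> A0 cA Ar x1; have r0 : 0 <= r.
  case: A0 => y /Ar; rewrite /cball /= subr0; exact: le_trans (enorm_ge0 _).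
rewrite -(support_fun_cball r0 x1); apply: support_fun_mono => //.
exact: cball_compact.
Qed.

Lemma support_fun_le_sub A r : (0 <= r) -> compact A ->
  (forall x, sphere R d x -> support_fun A x <= r) -> A `<=` cball 0 r.
Proof.
move=> r0 cA Ar x Ax; rewrite /cball /= subr0.
have [->|x0] := eqVneq x 0; first by rewrite enorm0.
apply: le_trans (Ar _ (enorm_normalized x0)).
apply: le_trans (support_fun_ge _ cA Ax).
rewrite dotZr -enorm_sqr expr2 mulrA mulVf ?mul1r//.
by rewrite gt_eqF// enorm_gt0.
Qed.

Lemma nearest A x : A !=set0 -> compact A ->
  exists2 y, A y & forall z, A z -> enorm (y - x) <= enorm (z - x).
Proof.
move=> A0 cA; have := @EVT_min_rV R d (fun z => enorm (z - x)) A A0 cA.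
case=> [|y].
  by apply: continuous_subspaceT; exact: edist_continuous.
by rewrite inE => Ay yA; exists y => // z Az; apply: yA; rewrite inE.
Qed.

(** Variational inequality of the projection: if some [z] violated it, moving from [y] towards [z]
    would come closer to [x]. *)
Lemma nearest_dot A x y : cvx A -> A y ->
  (forall z, A z -> enorm (y - x) <= enorm (z - x)) ->
  forall z, A z -> dot z (x - y) <= dot y (x - y).
Proof.
move=> cA Ay yA z Az; rewrite leNgt; apply/negP => lt_yz.
have p0 : 0 < dot (z - y) (x - y) by rewrite dotDl dotNl subr_gt0.
have zy0 : 0 < dot (z - y) (z - y).
  rewrite lt_neqAle dot_ge0 andbT eq_sym; apply/eqP => /dot_eq0 zy.
  by rewrite zy dot0l ltxx in p0.
(* [s] minimizes the distance to [x] along the segment from [y] to [z], capped so as not to go past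
   [z]. *)
pose s := Num.min 1 (dot (z - y) (x - y) / dot (z - y) (z - y)).
have s0 : 0 < s by rewrite lt_min ltr01 divr_gt0.
have s1 : s <= 1 by rewrite ge_min lexx.
have sq : s * dot (z - y) (z - y) <= dot (z - y) (x - y).
  by rewrite -ler_pdivlMr// ge_min lexx orbT.
have s01 : 0 <= s <= 1 by rewrite ltW.
have := yA _ (cA z y s Az Ay s01); rewrite -(@ler_pXn2r _ 2) ?nnegrE ?enorm_ge0// !enorm_sqr.
have -> : s *: z + (1 - s) *: y - x = s *: (z - y) - (x - y).
  by apply/rowP => i; rewrite !mxE; ring.
rewrite -[y - x]opprB; move: {s01} p0 s0 s1 sq zy0; move: (z - y) (x - y) s => p q t p0 t0 t1 sq zy0.
rewrite dotNl dotNr opprK dotDl !dotDr !(dotZl, dotZr, dotNl, dotNr) (dotC q p).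
nra.
Qed.

Lemma separation A x : cvx A -> compact A -> A !=set0 -> ~ A x ->
  exists2 v, sphere R d v & support_fun A v < dot x v.
Proof.
move=> cA kA A0 nAx; have [y Ay yA] := nearest x A0 kA.
have xy : x - y != 0.
  by apply/eqP => xy; apply: nAx; move/subr0_eq : xy => ->.
have n0 := enorm_gt0 xy.
exists ((enorm (x - y))^-1 *: (x - y)); first exact: enorm_normalized.
have yS := nearest_dot cA Ay yA.
rewrite (@support_fun_max _ _ y)//.
  rewrite !dotZr ltr_pM2l ?invr_gt0// -subr_gt0 -dotNl -dotDl.
  by rewrite -enorm_sqr exprn_gt0.
by move=> z Az; rewrite !dotZr ler_pM2l ?invr_gt0// yS.
Qed.

Lemma cball_sub_support A r : cvx A -> compact A -> A !=set0 ->
  (forall x, sphere R d x -> r <= support_fun A x) -> cball 0 r `<=` A.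
Proof.
move=> cA kA A0 rA x; rewrite /cball /= subr0 => xr; apply: contrapT => nAx.
have [v v1 xv] := separation cA kA A0 nAx.
have := rA v v1; have := dot_le x v; rewrite (_ : enorm v = 1)// mulr1; lra.
Qed.

Lemma support_fun_lip A M x y : A !=set0 -> compact A ->
  (forall z, A z -> enorm z <= M) ->
  support_fun A x <= support_fun A y + M * enorm (x - y).
Proof.
move=> A0 cA AM; have [z Az ->] := support_funP x A0 cA.
have := support_fun_ge y cA Az; have := dot_le z (x - y).
have := AM z Az; have := enorm_ge0 (x - y); rewrite !dotL; nra.
Qed.

End Bodies.

(** * Steiner and Minkowski symmetrizations as sets of mid-reflections *)

Section PairSymmetrization.
Context {R : realType} {d : nat}.
Implicit Types (x y z u v : 'rV[R]_d) (r t : R) (A B K : set 'rV[R]_d) (b : bool).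

(** For a unit [u], the component of [x - y] orthogonal to [u]. An equation, rather than the
    existence of a [t] with [x = y + t *: u], makes the constraint visibly closed in [u], [x] and
    [y] together. *)
Definition parallel_defect u x y := x - y - dot (x - y) u *: u.
Definition mid_reflection u x y := 2^-1 *: (x + reflection u y).

(* [b = true] gives the Steiner symmetral of a convex compact set, [b = false]
   the Minkowski symmetral of any set. *)
Definition psym b u A := [set z | exists x y, [/\ A x, A y,
  b -> parallel_defect u x y = 0 & z = mid_reflection u x y]].

Lemma psym_mono b u A B : A `<=` B -> psym b u A `<=` psym b u B.
Proof.
by move=> AB z [x [y [Ax Ay bxy ->]]]; exists x, y; split => //; exact: AB.
Qed.

Lemma psym_steiner_minkowski u A : psym true u A `<=` psym false u A.
Proof. by move=> z [x [y [Ax Ay _ ->]]]; exists x, y. Qed.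

Lemma mid_reflection_cvx u x y x' y' t :
  mid_reflection u (t *: x + (1 - t) *: x') (t *: y + (1 - t) *: y') =
  t *: mid_reflection u x y + (1 - t) *: mid_reflection u x' y'.
Proof.
rewrite /mid_reflection reflectionD !reflectionZ.
by apply/rowP => i; rewrite !mxE; ring.
Qed.

Lemma parallel_defect_cvx u x y x' y' t :
  parallel_defect u (t *: x + (1 - t) *: x') (t *: y + (1 - t) *: y') =
  t *: parallel_defect u x y + (1 - t) *: parallel_defect u x' y'.
Proof.
by apply/rowP => i; rewrite /parallel_defect !dotL !mxE; ring.
Qed.

Lemma psym_cvx b u A : cvx A -> cvx (psym b u A).
Proof.
move=> cA _ _ t [x [y [Ax Ay bxy ->]]] [x' [y' [Ax' Ay' bxy' ->]]] t01.
exists (t *: x + (1 - t) *: x'), (t *: y + (1 - t) *: y').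
split; [exact: cA|exact: cA| |by rewrite mid_reflection_cvx].
by move=> bT; rewrite parallel_defect_cvx bxy// bxy'// !scaler0 addr0.
Qed.

(** The direction may vary too: [psym_usc] needs continuity jointly in the direction and the two
    points. *)
Lemma mid_reflection_cvg (T : Type) (F : set_system T) (f g h : T -> 'rV[R]_d)
    u x y : Filter F -> f @ F --> u -> g @ F --> x -> h @ F --> y ->
  mid_reflection (f t) (g t) (h t) @[t --> F] --> mid_reflection u x y.
Proof.
move=> FF fu gx hy; apply: cvgZ; first exact: cvg_cst.
apply: cvgD => //.
apply: cvgB => //; apply: cvgZ => //.
by apply: cvgM; [exact: cvg_cst|exact: dot_cvg].
Qed.

Lemma parallel_defect_cvg (T : Type) (F : set_system T) (f g h : T -> 'rV[R]_d)
    u x y : Filter F -> f @ F --> u -> g @ F --> x -> h @ F --> y ->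
  parallel_defect (f t) (g t) (h t) @[t --> F] --> parallel_defect u x y.
Proof.
move=> FF fu gx hy; have gh : g t - h t @[t --> F] --> x - y by exact: cvgB.
by apply: cvgB => //; apply: cvgZ => //; exact: dot_cvg.
Qed.

Lemma psym_compact b u A : compact A -> compact (psym b u A).
Proof.
move=> cA.
have -> : psym b u A = (fun p => mid_reflection u p.1 p.2) @`
    ((A `*` A) `&` [set p | b -> parallel_defect u p.1 p.2 = 0]).
  apply/seteqP; split=> [z [x [y [Ax Ay bxy ->]]]|_ [[x y] [[Ax Ay] bxy] <-]].
    by exists (x, y).
  by exists x, y.
apply: continuous_compact.
  apply: continuous_subspaceT => -[x y].
  by apply: mid_reflection_cvg; [exact: cvg_cst|exact: cvg_fst|exact: cvg_snd].
apply: compact_closedI; first exact: compact_setX.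
case: b; last first.
  by rewrite (_ : mkset _ = setT); [exact: closedT|apply/seteqP; split].
rewrite (_ : mkset _ = (fun p => enorm (parallel_defect u p.1 p.2)) @^-1` [set t | t = 0]).
  apply: preimage_closed; last exact: closed_eq.
  move=> [x y] _; apply: (@continuous_comp _ _ _
    (fun p : 'rV[R]_d * 'rV[R]_d => parallel_defect u p.1 p.2)).
    by apply: parallel_defect_cvg; [exact: cvg_cst|exact: cvg_fst|exact: cvg_snd].
  exact: enorm_continuous.
apply/seteqP; split=> [p /= /(_ isT) ->|p /= /enorm_eq0 ->//].
by rewrite enorm0.
Qed.

(** Writing a point of the ball as [mid_reflection u x x + w], the witnesses [x + w] and
    [x + reflection u w] differ by a multiple of [u], so one pair serves both symmetrizations. *)
Lemma psym_cball b u x r : sphere R d u ->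
  cball (mid_reflection u x x) r `<=` psym b u (cball x r).
Proof.
move=> u1 z; rewrite /cball /= => zr.
pose w := z - mid_reflection u x x.
exists (x + w), (x + reflection u w); split.
- by rewrite /cball /= addrAC subrr add0r.
- by rewrite /cball /= addrAC subrr add0r enorm_reflection.
- move=> _; rewrite /parallel_defect /reflection; set W := w.
  by apply/rowP => i; rewrite !dotL (sphereP u1) !mxE; ring.
- rewrite {1}/mid_reflection reflectionD reflectionK//.
  rewrite [in RHS](_ : w = z - mid_reflection u x x)// /mid_reflection.
  by apply/rowP => i; rewrite !mxE; field.
Qed.

Lemma psym_body b u A : sphere R d u -> body A -> body (psym b u A).
Proof.
move=> u1 [cA kA [c [r [r0 rA]]]]; split.
- exact: psym_cvx.
- exact: psym_compact.
- exists (mid_reflection u c c), r; split => //.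
  exact: subset_trans (psym_cball b u1) (psym_mono rA).
Qed.

Lemma enorm_mid_reflection u x y : sphere R d u ->
  enorm (mid_reflection u x y) <= 2^-1 * (enorm x + enorm y).
Proof.
move=> u1; rewrite /mid_reflection enormZ ger0_norm ?invr_ge0//.
rewrite ler_pM2l ?invr_gt0// (le_trans (enormD _ _))//.
by rewrite (enorm_reflection _ u1).
Qed.

Lemma psym_sub_cball b u A r : sphere R d u ->
  A `<=` cball 0 r -> psym b u A `<=` cball 0 r.
Proof.
move=> u1 Ar _ [x [y [/Ar Ax /Ar Ay _ ->]]]; move: Ax Ay.
by rewrite /cball /= !subr0 => ? ?; have := enorm_mid_reflection x y u1; lra.
Qed.

Lemma minkowski_symE u A : minkowski_sym u A = psym false u A.
Proof.
apply/seteqP; split=> z.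
  by move=> [_ [x Ax [_ [y Ay <-] <-]] <-]; exists x, y.
move=> [x [y [Ax Ay _ ->]]]; exists (x + reflection u y) => //.
by exists x => //; exists (reflection u y) => //; exists y.
Qed.

Lemma dot_mid_reflection u x y v :
  dot (mid_reflection u x y) v = 2^-1 * (dot x v + dot y (reflection u v)).
Proof. by rewrite /mid_reflection dotZl (dotDl x) dot_reflection. Qed.

Lemma support_fun_minkowski u A x : A !=set0 -> compact A ->
  support_fun (psym false u A) x =
  2^-1 * (support_fun A x + support_fun A (reflection u x)).
Proof.
move=> A0 cA.
have [y Ay yA] := max_dot x A0 cA; have [z Az zA] := max_dot (reflection u x) A0 cA.
rewrite (support_fun_max Ay yA) (support_fun_max Az zA).
rewrite (@support_fun_max _ _ _ _ (mid_reflection u y z)).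
- by rewrite dot_mid_reflection.
- by exists y, z.
move=> _ [y' [z' [Ay' Az' _ ->]]]; rewrite !dot_mid_reflection.
by rewrite ler_pM2l ?invr_gt0// lerD ?yA ?zA.
Qed.

Lemma parallel_defectP u x y : sphere R d u ->
  parallel_defect u y x = 0 <-> exists t, y = x + t *: u.
Proof.
move=> u1; rewrite /parallel_defect; split=> [/subr0_eq yx|[t ->]].
  by exists (dot (y - x) u); rewrite -yx addrC subrK.
have -> : x + t *: u - x = t *: u by rewrite addrAC subrr add0r.
by rewrite dotZl sphereP// mulr1 subrr.
Qed.

Lemma cvx_line A x u r s t : cvx A -> A (x + r *: u) -> A (x + s *: u) ->
  r <= t <= s -> A (x + t *: u).
Proof.
move=> cA Ar As /andP[rt ts].
have [rs|rs] := eqVneq r s.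
  by have -> : t = r by apply/eqP; rewrite eq_le rt rs ts.
have sr0 : s - r != 0 by rewrite subr_eq0 eq_sym.
have sr : 0 < s - r by rewrite lt_neqAle eq_sym sr0 subr_ge0 (le_trans rt).
have st01 : 0 <= (s - t) / (s - r) <= 1.
  by rewrite divr_ge0 ?subr_ge0 ?(ltW sr)// ?(le_trans rt)//= ler_pdivrMr// mul1r lerB.
have := cA _ _ ((s - t) / (s - r)) Ar As st01; congr A; apply/rowP => i; rewrite !mxE.
by field.
Qed.

Lemma chord_shift u A x t : chord u A (x + t *: u) = chord u A x.
Proof.
apply/seteqP; split=> _ [s As <-].
  exists (t + s); last by rewrite scalerDl addrA.
  by move: As; rewrite /= -addrA -scalerDl.
exists (s - t); last by rewrite -addrA -scalerDl [t + _]addrC subrK.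
by rewrite /= -addrA -scalerDl [t + _]addrC subrK.
Qed.

Lemma chord_midpoint_shift u A x t :
  chord_midpoint u A (x + t *: u) = chord_midpoint u A x.
Proof. by rewrite /chord_midpoint chord_shift. Qed.

(** Compactness makes the [inf] and [sup] of the chord attained, so [chord_midpoint] is a true
    midpoint and no default value enters. *)
Lemma chord_ends u A x : sphere R d u -> compact A -> A x ->
  exists r s, [/\ A (x + r *: u), A (x + s *: u),
    forall t, A (x + t *: u) -> r <= t <= s &
    chord_midpoint u A x = dot x u + (r + s) / 2].
Proof.
move=> u1 cA Ax.
pose L := A `&` [set y | parallel_defect u y x = 0].
have cL : compact L.
  apply: compact_closedI => //.
  rewrite (_ : mkset _ = (fun y => enorm (parallel_defect u y x)) @^-1` [set t | t = 0]).
    apply: preimage_closed; last exact: closed_eq.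
    move=> y _; apply: (@continuous_comp _ _ _ (fun y => parallel_defect u y x)).
      by apply: (@parallel_defect_cvg _ (nbhs y)); [exact: cvg_cst|exact: cvg_id|exact: cvg_cst].
    exact: enorm_continuous.
  apply/seteqP; split=> [p /= ->|p /= /enorm_eq0 ->//]; exact: enorm0.
have L0 : L !=set0.
  by exists x; split => //; apply/parallel_defectP => //; exists 0; rewrite scale0r addr0.
have dotx t : dot (x + t *: u) u = dot x u + t.
  by rewrite !dotL sphereP// mulr1.
have LP t : A (x + t *: u) -> L (x + t *: u).
  by move=> At; split => //; apply/parallel_defectP => //; exists t.
have [y [Ay /parallel_defectP[]// s yE] yL] := max_dot u L0 cL.
have [z [Az /parallel_defectP[]// r zE] zL] := max_dot (- u) L0 cL.
rewrite {}yE in Ay yL; rewrite {}zE in Az zL.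
exists r, s; split => // [t At|].
  have := yL _ (LP _ At); have := zL _ (LP _ At).
  by rewrite !dotNr !dotx; lra.
rewrite /chord_midpoint.
have -> : chord u A x = [set dot y u | y in L].
  apply/seteqP; split=> [_ [t At <-]|_ [w [Aw /parallel_defectP[]// t wE] <-]].
    by exists (x + t *: u) => //; exact: LP.
  by exists t; [rewrite /= -wE|rewrite wE].
have xs := LP _ Ay; have xr := LP _ Az.
have -> : sup [set dot y u | y in L] = dot x u + s.
  by rewrite -dotx; exact: support_fun_max xs yL.
have -> : inf [set dot y u | y in L] = dot x u + r.
  rewrite -dotx; apply/eqP; rewrite eq_le; apply/andP; split.
    apply: ge_inf; last by exists (x + r *: u).
    exists (dot (x + r *: u) u) => _ [w Lw <-].
    by have := zL _ Lw; rewrite !dotNr lerN2.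
  apply: lb_le_inf; first by exists (dot (x + r *: u) u), (x + r *: u).
  by move=> _ [w Lw <-]; have := zL _ Lw; rewrite !dotNr lerN2.
by field.
Qed.

Lemma steiner_symE u A : sphere R d u -> cvx A -> compact A ->
  steiner_sym u A = psym true u A.
Proof.
move=> u1 cA kA; apply/seteqP; split=> [_ [x Ax <-]|_ [x [y [Ax Ay xy ->]]]].
  have [r [s [Ar As rsA ->]]] := chord_ends u1 kA Ax.
  have A0 : A (x + 0 *: u) by rewrite scale0r addr0.
  have /andP[r0 s0] := rsA 0 A0.
  (* The partner of [x] is its mirror image within its own chord: the symmetry exchanging the
     parameters [r] and [s] sends [0] to [r + s]. *)
  exists x, (x + (r + s) *: u); split => //.
  - by apply: (cvx_line cA Ar As); apply/andP; split; lra.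
  - move=> _; rewrite /parallel_defect opprD addrA subrr add0r.
    by rewrite dotNl dotZl sphereP// mulr1 scaleNr opprK addNr.
  - rewrite /mid_reflection /reflection dotDl dotZl sphereP//.
    by apply/rowP => i; rewrite !mxE; field.
have [r [s [Ar As rsA mE]]] := chord_ends u1 kA Ax.
have [t yE] : exists t, y = x + t *: u.
  apply/parallel_defectP => //; have := xy isT; rewrite /parallel_defect => xy0.
  by rewrite -[y - x]opprB dotNl scaleNr -opprD xy0 oppr0.
rewrite yE in Ay *.
have A0 : A (x + 0 *: u) by rewrite scale0r addr0.
have /andP[r0 s0] := rsA 0 A0; have /andP[rt st] := rsA t Ay.
(* Sliding brings the point of parameter [p] to height [p - (r + s) / 2], and the mid-reflection of
   [x] and [x + t *: u] has height [- t / 2]; this dictates [p]. *)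
exists (x + ((r + s - t) / 2) *: u).
  by apply: (cvx_line cA Ar As); apply/andP; split; lra.
rewrite chord_midpoint_shift mE /mid_reflection /reflection dotDl dotZl sphereP//.
by apply/rowP => i; rewrite !mxE; field.
Qed.

End PairSymmetrization.

(** * Hausdorff convergence to a ball *)

Section Hausdorff.
Context {R : realType} {d : nat}.
Implicit Types (x y z u v : 'rV[R]_d) (r e : R) (A B : set 'rV[R]_d).

Definition rounds_to (K : nat -> set 'rV[R]_d) r := forall e, 0 < e ->
  \forall n \near \oo, forall x, sphere R d x -> `|support_fun (K n) x - r| <= e.

Section OneSided.
Variables (X Y : set 'rV[R]_d) (g : 'rV[R]_d -> 'rV[R]_d -> R).
Hypothesis g0 : forall x y, 0 <= g x y.
Hypothesis Y0 : Y !=set0.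

Let hdev := [set inf [set g x y | y in Y] | x in X].

Let inf_ge0 x : 0 <= inf [set g x y | y in Y].
Proof.
by apply: lb_le_inf => [|_ [y _ <-]//]; case: Y0 => y Yy; exists (g x y), y.
Qed.

Let inf_le x y : Y y -> inf [set g x y | y in Y] <= g x y.
Proof.
by move=> Yy; apply: ge_inf; [exists 0 => _ [z _ <-]|exists y].
Qed.

(** The cost [g] is abstract because the two halves of [hausdorff_dist] use [enorm (a - b)] with the
    roles of [a] and [b] exchanged. *)
Lemma sup_inf_le e : X !=set0 ->
  (forall x, X x -> exists2 y, Y y & g x y <= e) -> 0 <= sup hdev <= e.
Proof.
move=> [x0 Xx0] H.
have ub (c : R) : hdev c -> c <= e.
  by move=> [x Xx <-]; have [y Yy /(le_trans _)] := H x Xx; apply; exact: inf_le.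
apply/andP; split.
  apply: le_trans (inf_ge0 x0) _; apply: ub_le_sup; first by exists e.
  by exists x0.
by apply: ge_sup; [exists (inf [set g x0 y | y in Y]), x0|exact: ub].
Qed.

(** The bound [M] ensures that [sup] is a genuine supremum, not a default value carrying no
    information. *)
Lemma sup_inf_lt M e : (forall x y, X x -> Y y -> g x y <= M) ->
  sup hdev < e -> forall x, X x -> exists2 y, Y y & g x y < e.
Proof.
move=> gM supe x Xx.
have : inf [set g x y | y in Y] < e.
  apply: le_lt_trans supe; apply: ub_le_sup; last by exists x.
  exists M => _ [z Xz <-]; case: Y0 => y Yy.
  by apply: le_trans (inf_le _ Yy) _; exact: gM.
rewrite -subr_gt0 => /inf_adherent H.
have [|_ [y Yy <-]] := H [set g x y | y in Y].
  split; last by exists 0 => _ [y _ <-].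
  by case: Y0 => y Yy; exists (g x y), y.
by rewrite addrC subrK => ?; exists y.
Qed.

End OneSided.

Lemma hausdorff_dist_support A r e : A !=set0 -> compact A -> 0 <= r ->
  hausdorff_dist A (cball 0 r) < e ->
  forall x, sphere R d x -> `|support_fun A x - r| <= e.
Proof.
move=> A0 cA r0; rewrite gt_max => /andP[s1 s2] x x1.
have [M _ AM] := compact_enorm cA.
have C0 : cball (0 : 'rV[R]_d) r !=set0 by exists 0; rewrite /cball /= subrr enorm0.
have gM y z : A y -> cball 0 r z -> enorm (y - z) <= M + r.
  move=> /AM ?; rewrite /cball /= subr0 => ?.
  by apply: le_trans (enormB _ _) _; lra.
have {s1}h1 := sup_inf_lt (fun _ _ => enorm_ge0 _) C0 gM s1.
have {s2}h2 := @sup_inf_lt _ _ (fun b a => enorm (a - b)) (fun _ _ => enorm_ge0 _) A0 (M + r) e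
  (fun y z yB zA => gM z y zA yB) s2.
rewrite ler_distl; apply/andP; split.
  have [|y Ay] := h2 (r *: x).
    by rewrite /cball /= subr0 enormZ (_ : enorm x = 1)// mulr1 ger0_norm.
  have := support_fun_ge x cA Ay; have := dot_le (r *: x - y) x.
  rewrite (_ : enorm x = 1)// mulr1 enormBC dotDl dotNl dotZl sphereP//; lra.
have [y Ay ->] := support_funP x A0 cA.
have [z] := h1 y Ay; rewrite /cball /= subr0 => zr yz.
have := dot_le (y - z) x; have := dot_le z x.
by rewrite (_ : enorm x = 1)// !mulr1 dotDl dotNl; lra.
Qed.

Lemma support_hausdorff_dist A r e : cvx A -> A !=set0 -> compact A ->
  0 <= r -> 0 <= e ->
  (forall x, sphere R d x -> `|support_fun A x - r| <= e) ->
  0 <= hausdorff_dist A (cball 0 r) <= e.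
Proof.
move=> cvA A0 cA r0 e0 H.
have C0 : cball (0 : 'rV[R]_d) r !=set0 by exists 0; rewrite /cball /= subrr enorm0.
have h1 y : A y -> exists2 z, cball 0 r z & enorm (y - z) <= e.
  move=> Ay; have : cball 0 (r + e) y.
    apply: (@support_fun_le_sub _ _ A) => //; first by rewrite addr_ge0.
    by move=> x /H; rewrite ler_distl => /andP[].
  rewrite /cball /= subr0 => yre.
  have [yr|ry] := leP (enorm y) r; first by exists y; rewrite /= ?subr0 ?subrr ?enorm0.
  have y0 : 0 < enorm y by exact: le_lt_trans ry.
  exists ((r / enorm y) *: y).
    by rewrite /= subr0 enormZ ger0_norm ?divr_ge0 ?enorm_ge0// divfK ?gt_eqF.
  rewrite -[X in enorm (X - _)]scale1r -scalerBl enormZ ger0_norm.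
    by rewrite mulrBl mul1r divfK ?gt_eqF//; lra.
  by rewrite subr_ge0 ler_pdivrMr// mul1r ltW.
have h2 x : cball 0 r x -> exists2 y, A y & enorm (y - x) <= e.
  rewrite /cball /= subr0 => xr.
  (* In the direction [v] from the nearest point [y] to [x], the support function of [A] is attained
     at [y], so [dot y v] is at least [r - e], while [dot x v <= r]; the gap between the two is the
     distance. *)
  have [y Ay yA] := nearest x A0 cA; exists y => //.
  have [->|xy] := eqVneq x y; first by rewrite subrr enorm0.
  rewrite -subr_eq0 in xy; have n0 := enorm_gt0 xy.
  have v1 := enorm_normalized xy; set v := _ *: _ in v1.
  have yS := nearest_dot cvA Ay yA.
  have := H _ v1; rewrite (@support_fun_max _ _ A _ y)//; last first.
    by move=> z Az; rewrite /v !dotZr ler_pM2l ?invr_gt0// yS.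
  rewrite ler_distl => /andP[fr _]; have := dot_le x v; rewrite v1 mulr1.
  have : dot (x - y) v = enorm (x - y).
    by rewrite /v dotZr -enorm_sqr expr2 mulrA mulVf ?mul1r// gt_eqF.
  by rewrite (dotDl x) dotNl (enormBC y); lra.
have /andP[a1 b1] := sup_inf_le (fun _ _ => enorm_ge0 _) C0 A0 h1.
have /andP[a2 b2] := @sup_inf_le (cball 0 r) A (fun b a => enorm (a - b))
  (fun _ _ => enorm_ge0 _) A0 e C0 h2.
by rewrite /hausdorff_dist le_max a1 ge_max b1 b2.
Qed.

Lemma hausdorff_cvgP (K : nat -> set 'rV[R]_d) r : 0 <= r ->
  (forall n, body (K n)) ->
  hausdorff_cvg K (dilate r (unit_ball R d)) <-> rounds_to K r.
Proof.
move=> r0 bK; rewrite /hausdorff_cvg dilate_unit_ball//; split.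
  move=> /(@cvgrPdist_lt _ _ _ (nbhs \oo)) H e e0; move: (H e e0).
  apply: filterS => n; rewrite sub0r normrN => /(le_lt_trans (ler_norm _)).
  by have [_ kK _] := bK n; apply: hausdorff_dist_support => //; exact: body_nonempty.
move=> H; apply/(@cvgrPdist_le _ _ _ (nbhs \oo)) => e e0; move: (H e e0).
apply: filterS => n He; have [cK kK _] := bK n.
have /andP[h0 he] := support_hausdorff_dist cK (body_nonempty (bK n)) kK r0 (ltW e0) He.
by rewrite sub0r normrN ger0_norm.
Qed.

End Hausdorff.

(** * Iterated symmetrizations *)

Section Iteration.
Context {R : realType} {d : nat}.
Implicit Types (A B K : set 'rV[R]_d) (T : 'rV[R]_d -> set 'rV[R]_d -> set 'rV[R]_d)
  (u : nat -> 'rV[R]_d) (b : bool).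

Lemma iter_sym_nil T u k A : iter_sym T u k k A = A.
Proof. by rewrite /iter_sym /index_iota subnn. Qed.

Lemma iter_symS T u k n A : (k <= n)%N ->
  iter_sym T u k n.+1 A = T (u n) (iter_sym T u k n A).
Proof.
move=> kn; rewrite /iter_sym /index_iota subSn// -[(n - k).+1]addn1 iotaD foldl_cat /=.
by rewrite subnKC.
Qed.

Lemma iter_sym_split T u k m n A : (k <= m)%N -> (m <= n)%N ->
  iter_sym T u k n A = iter_sym T u m n (iter_sym T u k m A).
Proof.
move=> km; elim: n => [|n IHn] mn.
  by move: mn; rewrite leqn0 => /eqP m0; move: km; rewrite m0 leqn0 => /eqP ->; rewrite !iter_sym_nil.
move: mn; rewrite leq_eqVlt => /orP[/eqP ->|mn]; first by rewrite iter_sym_nil.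
by rewrite !iter_symS ?IHn// (leq_trans km).
Qed.

Lemma iter_sym_shift T u k n A :
  iter_sym T u k (k + n) A = iter_sym T (fun i => u (k + i)%N) 0 n A.
Proof.
elim: n => [|n IHn]; first by rewrite addn0 !iter_sym_nil.
by rewrite addnS !iter_symS ?leq_addr// IHn.
Qed.

Local Notation piter b := (iter_sym (@psym R d b)).

Lemma piter_body b u k n A : (forall i, sphere R d (u i)) -> body A ->
  body (piter b u k n A).
Proof.
move=> u1 bA; have [kn|nk] := leqP k n; last first.
  by rewrite /iter_sym /index_iota (_ : (n - k = 0)%N)//; apply/eqP; rewrite subn_eq0 ltnW.
rewrite -(subnKC kn) iter_sym_shift.
elim: (n - k)%N => [|m IHm]; first by rewrite iter_sym_nil.
by rewrite iter_symS//; exact: psym_body.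
Qed.

Lemma piter_compact b u n A : compact A -> compact (piter b u 0 n A).
Proof.
move=> cA; elim: n => [|n IHn]; first by rewrite iter_sym_nil.
by rewrite iter_symS//; exact: psym_compact.
Qed.

Lemma piter_mono b u k n A B : A `<=` B -> piter b u k n A `<=` piter b u k n B.
Proof.
rewrite /iter_sym; elim: (index_iota k n) A B => [//|i s IHs] A B AB /=.
by apply: IHs; exact: psym_mono.
Qed.

Lemma piter_steiner_minkowski u k n A :
  piter true u k n A `<=` piter false u k n A.
Proof.
rewrite /iter_sym; elim: (index_iota k n) A => [|i s IHs] A /=; first exact: subset_refl.
apply: subset_trans (IHs _) _.
have : psym true (u i) A `<=` psym false (u i) A by exact: psym_steiner_minkowski.
move: (psym true _ _) (psym false _ _) => B C.
elim: s {IHs} B C => [//|j s IHs] B C BC /=.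
by apply: IHs; exact: psym_mono.
Qed.

Lemma piter_sub_cball b u k n A r : (forall i, sphere R d (u i)) ->
  A `<=` cball 0 r -> piter b u k n A `<=` cball 0 r.
Proof.
move=> u1; rewrite /iter_sym; elim: (index_iota k n) A => [//|i s IHs] A Ar /=.
by apply: IHs; exact: psym_sub_cball.
Qed.

Lemma iter_steinerE u k n A : (forall i, sphere R d (u i)) -> body A ->
  iter_sym (@steiner_sym R d) u k n A = piter true u k n A.
Proof.
move=> u1; rewrite /iter_sym; elim: (index_iota k n) A => [//|i s IHs] A bA /=.
have [cA kA _] := bA; rewrite steiner_symE//; apply: IHs; exact: psym_body.
Qed.

Lemma iter_minkowskiE u k n A :
  iter_sym (@minkowski_sym R d) u k n A = piter false u k n A.
Proof.
rewrite /iter_sym; elim: (index_iota k n) A => [//|i s IHs] A /=.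
by rewrite minkowski_symE.
Qed.

Definition thicken K (e : R) := [set x | exists2 y, K y & enorm (x - y) < e].

Lemma thicken_open K e : open (thicken K e).
Proof.
rewrite openE => x [y Ky xy]; apply/nbhs_enormP.
exists (e - enorm (x - y)); first by rewrite subr_gt0.
move=> z xz; exists y => //; have := enorm_distD z x y.
by rewrite (enormBC z x); lra.
Qed.

Lemma sub_thicken K e : 0 < e -> K `<=` thicken K e.
Proof. by move=> e0 x Kx; exists x => //; rewrite subrr enorm0. Qed.

(** A tube argument over the compact set of pairs: at each pair either the parallelism constraint
    fails, which is an open condition, or the mid-reflection lies in the open set [G]. Thickening
    [K] while moving [v] is what allows several steps to be chained. *)
Lemma psym_usc b (v : 'rV[R]_d) K (G : set 'rV[R]_d) : compact K -> open G ->
  psym b v K `<=` G ->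
  exists2 e, 0 < e & forall w, enorm (v - w) < e -> psym b w (thicken K e) `<=` G.
Proof.
move=> kK oG KG.
(* The parameter [i] consists of the direction and of the displacements of the two points away from
   [K]. *)
pose P (i : 'rV[R]_d * ('rV[R]_d * 'rV[R]_d)) (p : 'rV[R]_d * 'rV[R]_d) :=
  (b -> parallel_defect i.1 (p.1 + i.2.1) (p.2 + i.2.2) = 0) ->
  G (mid_reflection i.1 (p.1 + i.2.1) (p.2 + i.2.2)).
pose z0 : 'rV[R]_d * ('rV[R]_d * 'rV[R]_d) := (v, (0, 0)).
have := compact_setX kK kK; rewrite compact_near_coveringP.
move=> /(_ _ (nbhs z0) P (nbhs_filter _)) H.
have {H} /nbhs_ballP[e0 /= e00 H] : \forall i \near z0, K `*` K `<=` P i.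
  apply: H => -[x y] [/= Kx Ky].
  pose F := filter_prod (nbhs (x, y)) (nbhs z0).
  have FF : Filter F by exact: filter_prod_filter.
  pose V := (('rV[R]_d * 'rV[R]_d) * ('rV[R]_d * ('rV[R]_d * 'rV[R]_d)))%type.
  have f1 : (fun q : V => q.1.1) @ F --> x by apply: (cvg_comp _ _ cvg_fst cvg_fst).
  have f2 : (fun q : V => q.1.2) @ F --> y by apply: (cvg_comp _ _ cvg_fst cvg_snd).
  have g1 : (fun q : V => q.2.1) @ F --> v by apply: (cvg_comp _ _ cvg_snd cvg_fst).
  have g23 : (fun q : V => q.2.2) @ F --> (0 : 'rV[R]_d, 0 : 'rV[R]_d).
    by apply: (cvg_comp _ _ cvg_snd cvg_snd).
  have g2 : (fun q : V => q.2.2.1) @ F --> (0 : 'rV[R]_d) by apply: (cvg_comp _ _ g23 cvg_fst).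
  have g3 : (fun q : V => q.2.2.2) @ F --> (0 : 'rV[R]_d) by apply: (cvg_comp _ _ g23 cvg_snd).
  have h1 : (fun q : V => q.1.1 + q.2.2.1) @ F --> x by rewrite -[x]addr0; exact: cvgD.
  have h2 : (fun q : V => q.1.2 + q.2.2.2) @ F --> y by rewrite -[y]addr0; exact: cvgD.
  have [[bT nz]|z] := pselect (b /\ parallel_defect v x y <> 0).
    have := cvg_comp _ _ (parallel_defect_cvg FF g1 h1 h2)
      (@enorm_continuous R d (parallel_defect v x y)).
    move=> /(_ [set t | t != 0]) /= W.
    have : F (fun q : V => enorm (parallel_defect q.2.1 (q.1.1 + q.2.2.1) (q.1.2 + q.2.2.2)) != 0).
      apply: W; apply: open_nbhs_nbhs; split; first exact: open_neq.
      by apply/eqP => /enorm_eq0.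
    by apply: filterS => q /eqP q0 /(_ bT) qE; rewrite qE enorm0 in q0.
  have := mid_reflection_cvg FF g1 h1 h2 => /(_ G) /= W.
  have : F (fun q : V => G (mid_reflection q.2.1 (q.1.1 + q.2.2.1) (q.1.2 + q.2.2.2))).
    apply: W; apply: open_nbhs_nbhs; split => //; apply: KG; exists x, y; split => //.
    by move=> bT; apply: contrapT => nz; apply: z.
  by apply: filterS => q Gq _.
exists e0 => // w vw _ [x' [y' [[x Kx xx'] [y Ky yy'] bxy ->]]].
have bl (a c : 'rV[R]_d) : enorm (a - c) < e0 -> ball a e0 c.
  by move=> ac; rewrite -ball_normE /=; exact: le_lt_trans (norm_le_enorm _) ac.
have wB : ball z0 e0 (w, (x' - x, y' - y)).
  by split; [exact: bl|split; apply: bl; rewrite sub0r enormN].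
have := H _ wB (x, y) (conj Kx Ky); rewrite /P /=.
by rewrite !(addrC _ (_ - _)) !subrK; exact.
Qed.

(** The last step accepts a thickening of the previous iterate, and this thickening is an open
    target for the induction hypothesis. *)
Lemma piter_usc b u K n (G : set 'rV[R]_d) : compact K -> open G ->
  piter b u 0 n K `<=` G ->
  exists2 e, 0 < e & forall u', (forall i, (i < n)%N -> enorm (u i - u' i) < e) ->
    piter b u' 0 n K `<=` G.
Proof.
move=> kK; elim: n G => [|n IHn] G oG.
  by rewrite iter_sym_nil => KG; exists 1 => // u' _; rewrite iter_sym_nil.
rewrite iter_symS// => KG.
have [e e0 He] := psym_usc (piter_compact kK) oG KG.
have [e' e0' He'] := IHn _ (@thicken_open (piter b u 0 n K) e) (sub_thicken e0).
exists (Num.min e e'); first by rewrite lt_min e0.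
move=> u' uu'; rewrite iter_symS//.
apply: subset_trans (He (u' n) _); last first.
  by have := uu' n (ltnSn n); rewrite lt_min => /andP[].
apply: psym_mono; apply: He' => i ni.
by have := uu' i (ltnW ni); rewrite lt_min => /andP[].
Qed.

End Iteration.

(** * Volume *)

Section Volume.
Context {R : realType}.
Local Notation leb := (@lebesgue_measure R).

Lemma rat_dense (x e : R) : 0 < e -> exists q : rat, `|x - ratr q| < e.
Proof.
move=> e0; have /rat_in_itvoo[q] : x - e < x + e by lra.
by rewrite in_itv /= => /andP[? ?]; exists q; rewrite ltr_distl; lra.
Qed.

Lemma rat_dense_rV n (x : 'rV[R]_n) (e : R) : 0 < e ->
  exists q : 'rV[rat]_n, `|x - map_mx ratr q| < e.
Proof.
move=> e0; have e2 : 0 < e / 2 by rewrite divr_gt0.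
have /choice[f fP] i := rat_dense (x 0 i) e2.
exists (\row_i f i); apply: (@le_lt_trans _ _ (e / 2)); last by lra.
by apply: norm_leP; [exact: ltW|move=> i; rewrite !mxE ltW].
Qed.

(** This places open sets of a product in the product sigma-algebra; it serves both for R x R^m and
    for spaces of sequences. *)
Lemma measurable_countable_base d (T : measurableType d) (I : countType)
    (B : I -> set T) (W : set T) : (forall i, measurable (B i)) ->
  (forall x, W x -> exists2 i, B i x & B i `<=` W) -> measurable W.
Proof.
move=> mB WB.
have -> : W = \bigcup_i (if `[< B i `<=` W >] then B i else set0).
  apply/seteqP; split=> [x /WB[i Bix BiW]|x [i _]].
    by exists i => //; rewrite asboolT.
  by case: asboolP => // /[apply].
apply: countable_bigcupT_measurable; first exact: countableP.
by move=> i; case: ifP.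
Qed.

Lemma row_mx_ord0 m (x : R) (y : 'rV[R]_m) :
  (row_mx (x%:M : 'M[R]_1) y : 'rV[R]_m.+1) 0 0 = x.
Proof.
rewrite mxE; case: splitP => j; first by rewrite !mxE (ord1 j) eqxx mulr1n.
by move=> /eqP; rewrite /= eq_sym.
Qed.

Lemma row_mx_lift m (x : R) (y : 'rV[R]_m) i :
  (row_mx (x%:M : 'M[R]_1) y : 'rV[R]_m.+1) 0 (lift 0 i) = y 0 i.
Proof.
rewrite mxE; case: splitP => j; first by rewrite (ord1 j).
by rewrite lift0 /= add1n => -[] /ord_inj ->.
Qed.

Lemma norm_row_mx m (x x' : R) (y y' : 'rV[R]_m) e :
  `|x - x'| <= e -> `|y - y'| <= e ->
  `|(row_mx (x%:M : 'M[R]_1) y : 'rV[R]_m.+1) - row_mx (x'%:M : 'M[R]_1) y'| <= e.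
Proof.
move=> xe ye; apply: norm_leP => [|i]; first exact: le_trans xe.
rewrite !mxE; case: splitP => j _; first by rewrite !mxE (ord1 j) eqxx !mulr1n.
by apply: le_trans ye; have := norm_entry (y - y') j; rewrite !mxE.
Qed.

(** The splitting of R^(m+1) underlying [volume], which becomes the pushforward of a product measure
    by this map. *)
Definition cons_rV m (p : measurableTypeR R * borel_rV R m) : borel_rV R m.+1 :=
  row_mx (p.1%:M : 'M[R]_1) (p.2 : 'rV[R]_m).

Lemma measurable_cons_rV m : measurable_fun setT (@cons_rV m).
Proof.
have H := @measurability _ _ _ _ setT (@cons_rV m) (@open 'rV[R]_m.+1) erefl.
apply: H.
move=> _ [W oW <-]; rewrite setTI.
pose B (i : rat * 'rV[rat]_m * nat) : set (measurableTypeR R * borel_rV R m) :=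
  ball (ratr i.1.1 : R) i.2.+1%:R^-1 `*` ball (map_mx ratr i.1.2 : 'rV[R]_m) i.2.+1%:R^-1.
apply: (@measurable_countable_base _ _ _ B).
  move=> [[q v] k]; apply: measurableX.
    by apply: open_measurable; exact: ball_open.
  by apply: sub_sigma_algebra; exact: ball_open.
move=> [x y] /= Wxy.
have : nbhs (cons_rV (x, y) : 'rV[R]_m.+1) W by exact: open_nbhs_nbhs.
move=> /nbhs_ballP[e /= e0 eW].
have [k] : exists k, 0 + k.+1%:R^-1 < e / 2 by apply: ltr_add_invr; rewrite divr_gt0.
rewrite add0r => ke.
have k0 : 0 < k.+1%:R^-1 :> R by rewrite invr_gt0.
have [q qx] := rat_dense x k0; have [v vy] := rat_dense_rV y k0.
exists (q, v, k); rewrite /B /= -!ball_normE /=.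
  by split; rewrite distrC.
move=> [x' y'] /= [qx' vy']; apply: eW; rewrite -ball_normE /=.
apply: (@le_lt_trans _ _ (k.+1%:R^-1 + k.+1%:R^-1)); last by rewrite [ltRHS]splitr ltrD.
apply: norm_row_mx.
  apply: le_trans (ler_distD (ratr q) _ _) _; apply: lerD; exact: ltW.
apply: le_trans (ler_distD (map_mx ratr v : 'rV[R]_m) _ _) _; apply: lerD; exact: ltW.
Qed.

Lemma volume0 n : volume (set0 : set 'rV[R]_n) = 0%E.
Proof.
elim: n => [|n IHn] /=; first by rewrite indic0.
by apply: integral0_eq => x _; exact: IHn.
Qed.

Definition cube n (a : R) : set 'rV[R]_n := [set x | forall i, `|x 0 i| <= a].

Lemma volume_cube n (a : R) : 0 <= a ->
  volume (@cube n a) = ((a *+ 2) ^+ n)%:E.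
Proof.
move=> a0; elim: n => [|n IHn] /=.
  by rewrite expr0 indicE mem_set// => -[].
transitivity (\int[leb]_(x in `[(- a)%R, a]) ((a *+ 2) ^+ n)%:E)%E; last first.
  rewrite integral_cst//= lebesgue_measure_itv /= lte_fin.
  have [aa|aa] := ltP (- a) a.
    by rewrite -EFinD -EFinM opprK -mulr2n exprSr.
  have -> : a = 0 by lra.
  by rewrite mul0rn mule0 expr0n.
rewrite [RHS]integral_mkcond; apply: eq_integral => x _.
rewrite patchE; case: ifPn; rewrite ?inE ?notin_setE /= in_itv /= -ler_norml => xa.
  rewrite -IHn; congr volume; apply/seteqP; split=> y /= yc i.
    by have := yc (lift 0 i); rewrite row_mx_lift.
  case: (unliftP 0 i) => [j|] ->; first by rewrite row_mx_lift; exact: yc.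
  by rewrite row_mx_ord0.
rewrite (_ : mkset _ = set0) ?volume0//; apply/seteqP; split=> // y /= yc.
by apply: xa; have := yc 0; rewrite row_mx_ord0.
Qed.

Lemma cubeE n (a : R) : 0 <= a -> @cube n a = [set x | `|x| <= a].
Proof.
move=> a0; apply/seteqP; split=> x; first exact: norm_leP.
by move=> xa i; exact: le_trans (norm_entry _ _) xa.
Qed.

Lemma bigcup_cube n : setT = \bigcup_k (@cube n k%:R).
Proof.
apply/seteqP; split=> // x _; exists (Num.bound `|x|) => //.
by rewrite cubeE//= ltW// archi_boundP.
Qed.

Lemma closed_borel n (A : set (borel_rV R n)) :
  closed (A : set 'rV[R]_n) -> measurable A.
Proof.
move=> cA; rewrite -[A]setCK; apply: measurableC.
by apply: sub_sigma_algebra; exact: closed_openC.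
Qed.

Lemma compact_borel n (A : set (borel_rV R n)) :
  compact (A : set 'rV[R]_n) -> measurable A.
Proof. by move=> cA; apply: closed_borel; exact: rV_closed. Qed.

Lemma cube_measurable n (a : R) : 0 <= a -> measurable (@cube n a : set (borel_rV R n)).
Proof.
move=> a0; apply: closed_borel; rewrite cubeE//.
apply: (@preimage_closed _ _ (fun x : 'rV[R]_n => `|x|) [set t | t <= a]).
  by move=> x _; exact: norm_continuous.
exact: closed_le.
Qed.

Lemma section_cons_rV n (A : set (borel_rV R n.+1)) (x : R) :
  [set y : 'rV[R]_n | A (row_mx (x%:M : 'M[R]_1) y)] =
  xsection (@cons_rV n @^-1` A) x.
Proof. by apply/seteqP; split=> y; rewrite /xsection /= inE. Qed.

(** [volume] is a bare function on all sets, so measure theory reaches it only through this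
    agreement on Borel sets. Sigma-finiteness is carried through the induction because the next
    product needs it; the cubes of integer half-side provide it. *)
Lemma volume_measure n :
  exists mu : {sigma_finite_measure set (borel_rV R n) -> \bar R},
    forall A : set (borel_rV R n), measurable A -> volume A = mu A.
Proof.
elim: n => [|n [mu muE]].
  by exists [the {sigma_finite_measure set (borel_rV R 0) -> \bar R} of
    dirac (0 : borel_rV R 0)].
pose nu := pushforward (leb \x mu)%E (@cons_rV n).
have nuE (A : set (borel_rV R n.+1)) : measurable A -> volume A = nu A.
  move=> mA; rewrite /nu /pushforward /product_measure1 /=.
  apply: eq_integral => x _; rewrite section_cons_rV /= muE//.
  apply: measurable_xsection; rewrite -[X in measurable X]setTI.
  exact: measurable_cons_rV.
pose nu1 : {measure set (borel_rV R n.+1) -> \bar R} :=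
  measure_function_pushforward__canonical__measure_function_Measure (leb \x mu)%E (@measurable_cons_rV n).
have sf : sigma_finite setT nu1.
  exists (fun k => @cube n.+1 k%:R); first exact: bigcup_cube.
  move=> k; have mC := @cube_measurable n.+1 k%:R (ler0n _ _).
  by split => //; rewrite -[nu1 _]/(nu _) -nuE// volume_cube// ltry.
pose H2 := isSFinite.Build _ _ _ nu1 (sfinite_measure_sigma_finite sf).
pose H3 := isSigmaFinite.Build _ _ _ nu1 sf.
pose nu2 := HB.pack_for {sigma_finite_measure set (borel_rV R n.+1) -> \bar R}
  (Measure.sort nu1) H2 H3.
by exists nu2.
Qed.

End Volume.

(** * Affine changes of variables and Cavalieri's principle along the axes *)

Section Cavalieri.
Context {R : realType}.
Local Notation leb := (@lebesgue_measure R).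

Definition affineR (c t : R) : measurableTypeR R -> measurableTypeR R :=
  fun x => c * x + t.

Lemma measurable_affineR c t : measurable_fun setT (affineR c t).
Proof.
apply: continuous_measurable_fun => x.
by apply: cvgD; [apply: cvgM; [exact: cvg_cst|exact: cvg_id]|exact: cvg_cst].
Qed.

(** By uniqueness of Lebesgue measure: the pushforward rescaled by [c] has the right values on
    half-open intervals. *)
Lemma lebesgue_measure_affine (c t : R) (A : set (measurableTypeR R)) :
  0 < c -> measurable A ->
  leb (affineR c t @^-1` A) = (c^-1%:E * leb A)%E.
Proof.
move=> c0 mA.
have ci0 : 0 <= c by exact: ltW.
pose nu : {measure set (measurableTypeR R) -> \bar R} :=
  measure_function_pushforward__canonical__measure_function_Measure leb (measurable_affineR c t).
have -> : leb A = mscale (NngNum ci0) nu A.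
  apply: lebesgue_measure_unique mA => _ [[a b]] _ <-.
  transitivity (c%:E * leb (affineR c t @^-1` `]a, b]%classic))%E => //.
  have -> : affineR c t @^-1` `]a, b]%classic = `](a - t) / c, (b - t) / c]%classic.
    apply/seteqP; split=> x; rewrite /= !in_itv /= /affineR.
      by rewrite ltr_pdivrMr// ler_pdivlMr// => /andP[? ?]; apply/andP; split; lra.
    by rewrite ltr_pdivrMr// ler_pdivlMr// => /andP[? ?]; apply/andP; split; lra.
  rewrite !lebesgue_measure_itv /= !lte_fin ltr_pM2r ?invr_gt0// ltrD2r.
  case: ifPn => // _; last by rewrite mule0.
  by rewrite -!EFinD -EFinM; congr EFin; field; rewrite gt_eqF.
by rewrite /mscale /= muleA -EFinM mulVf ?mul1e ?gt_eqF.
Qed.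

Lemma integral_affine (c t : R) (f : measurableTypeR R -> \bar R) : 0 < c ->
  measurable_fun setT f -> (forall x, 0 <= f x)%E ->
  (\int[leb]_x f (c * x + t)%R = c^-1%:E * \int[leb]_x f x)%E.
Proof.
move=> c0 mf f0.
have ci0 : 0 <= c^-1 by rewrite invr_ge0 ltW.
have := ge0_integral_pushforward (measurable_affineR c t) leb measurableT mf (fun x _ => f0 x).
rewrite preimage_setT => H.
transitivity (\int[pushforward leb (affineR c t)]_x f x)%E; first by rewrite H.
transitivity (\int[mscale (NngNum ci0) leb]_x f x)%E; last first.
  by rewrite ge0_integral_mscale.
apply: (@eq_measure_integral _ _ _ setT (mscale (NngNum ci0) leb)
  (measure_function_pushforward__canonical__measure_function_Measure leb (measurable_affineR c t))).
by move=> A mA _; exact: lebesgue_measure_affine.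
Qed.

Lemma volume_affine n (c : R) (v : 'rV[R]_n) (A : set (borel_rV R n)) : 0 < c ->
  measurable A ->
  volume [set x : 'rV[R]_n | A (c *: x + v)] = ((c^-1 ^+ n)%:E * volume A)%E.
Proof.
move=> c0; elim: n v A => [|n IHn] v A mA.
  rewrite expr0 mul1e /=; congr (\1_ _ _)%:E.
  by apply/seteqP; split=> x /=; rewrite !(thinmx0 (_ + _)) (thinmx0 x).
have [mu muE] := @volume_measure R n.
have mcA : measurable (@cons_rV R n @^-1` A).
  by rewrite -[X in measurable X]setTI; exact: measurable_cons_rV.
pose f (x : measurableTypeR R) :=
  volume [set y : 'rV[R]_n | A (row_mx (x%:M : 'M[R]_1) y)].
have fE : f = mu \o xsection (@cons_rV R n @^-1` A).
  by apply/funext => x; rewrite /f section_cons_rV muE//; exact: measurable_xsection.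
have mf : measurable_fun setT f by rewrite fE; exact: measurable_fun_xsection.
have f0 x : (0 <= f x)%E by rewrite fE.
transitivity (\int[leb]_x ((c^-1 ^+ n)%:E * f (c * x + v 0 0)%R))%E.
  apply: eq_integral => x _; rewrite /f -(IHn (\row_j v 0 (lift 0 j))).
    congr volume; apply/funext => y /=; congr A; apply/rowP => i.
    case: (unliftP 0 i) => [j|] ->.
      by rewrite row_mx_lift [LHS]mxE [X in X + _]mxE row_mx_lift !mxE.
    by rewrite row_mx_ord0 [LHS]mxE [X in X + _]mxE row_mx_ord0.
  by rewrite section_cons_rV; exact: measurable_xsection.
have mfa : measurable_fun setT (fun x : measurableTypeR R => f (c * x + v 0 0)).
  exact: measurableT_comp mf (measurable_affineR c (v 0 0)).
rewrite ge0_integralZl//; last by rewrite lee_fin exprn_ge0 ?invr_ge0 ?ltW.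
by rewrite integral_affine// muleA -EFinM -exprSr.
Qed.

Lemma line_cvg n (x v : 'rV[R]_n) : continuous (fun t : R => x + t *: v).
Proof.
by move=> t; apply: cvgD; [exact: cvg_cst|apply: cvgZ; [exact: cvg_id|exact: cvg_cst]].
Qed.

Lemma line_closed n (A : set 'rV[R]_n) x v : closed A ->
  closed [set t : R | A (x + t *: v)].
Proof.
move=> cA; apply: (@preimage_closed _ _ (fun t : R => x + t *: v)) => //.
by move=> t _; exact: line_cvg.
Qed.

(** Measured in the parameter [t]: for nonzero [v] this is the length divided by the norm of [v],
    and it serves only to compare two sets. *)
Definition line_length n (v : 'rV[R]_n) (A : set 'rV[R]_n) x :=
  leb [set t : R | A (x + t *: v)].

Lemma line_length_shift n (v : 'rV[R]_n) (A : set 'rV[R]_n) x s : closed A ->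
  line_length v A (x + s *: v) = line_length v A x.
Proof.
move=> cA; rewrite /line_length.
have mA : measurable ([set t : R | A (x + t *: v)] : set (measurableTypeR R)).
  by apply: closed_measurable; exact: line_closed.
have := lebesgue_measure_affine s ltr01 mA.
rewrite invr1 mul1e => <-; congr (leb _); apply/funext => t.
by rewrite /affineR /= mul1r -addrA -scalerDl [s + t]addrC.
Qed.

(** For a later coordinate the slices are compared by induction. For the first one, which [volume]
    integrates outermost, the order of integration has to be exchanged. *)
Lemma cavalieri n (i : 'I_n) (A B : set (borel_rV R n)) :
  measurable A -> measurable B ->
  (forall x, line_length (delta_mx 0 i) A x = line_length (delta_mx 0 i) B x) ->
  volume A = volume B.
Proof.
elim: n i A B => [|n IHn] i A B mA mB; first by case: i => -[].
have mc (C : set (borel_rV R n.+1)) : measurable C -> measurable (@cons_rV R n @^-1` C).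
  by move=> mC; rewrite -[X in measurable X]setTI; exact: measurable_cons_rV.
have deltaE t x (y : 'rV[R]_n) j :
    (row_mx (x%:M : 'M[R]_1) (y + t *: delta_mx 0 j) : 'rV[R]_n.+1) =
    (row_mx (x%:M : 'M[R]_1) y : 'rV[R]_n.+1) + t *: delta_mx 0 (lift 0 j).
  apply/rowP => k; case: (unliftP 0 k) => [l|] ->.
    by rewrite row_mx_lift [RHS]mxE row_mx_lift !mxE (inj_eq (@lift_inj _ _)).
  by rewrite row_mx_ord0 [RHS]mxE row_mx_ord0 !mxE mulr0 addr0.
case: (unliftP 0 i) => [j|] -> AB.
  rewrite /=; apply: eq_integral => x _; apply: (IHn j).
  - by rewrite section_cons_rV; apply: measurable_xsection; exact: mc.
  - by rewrite section_cons_rV; apply: measurable_xsection; exact: mc.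
  move=> y; have := AB (row_mx (x%:M : 'M[R]_1) y); rewrite /line_length /=.
  by under eq_set do rewrite -deltaE; under [in RHS]eq_set do rewrite -deltaE.
have [mu muE] := @volume_measure R n.
have volE (C : set (borel_rV R n.+1)) : measurable C ->
    volume C = (\int[mu]_y (line_length (delta_mx 0 0) C (row_mx (0%:M : 'M[R]_1) y))%R)%E.
  move=> mC; have mC' := mc _ mC.
  transitivity ((leb \x mu)%E (@cons_rV R n @^-1` C)).
    apply: eq_integral => x _; rewrite section_cons_rV [RHS]/= -muE//; exact: measurable_xsection.
  (* Tonelli: the product measure is also computed from the slices in the other order. *)
  rewrite (@product_measure_unique _ _ _ _ _ leb mu (leb \x^ mu)%E)//; last first.
    by move=> A1 A2 mA1 mA2; exact: product_measure2E.
  apply: eq_integral => y _; congr (leb _).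
  apply/funext => x; rewrite /ysection /= propeqE inE /cons_rV /=.
  suff -> : (row_mx (x%:M : 'M[R]_1) y : 'rV[R]_n.+1) =
      (row_mx (0%:M : 'M[R]_1) y : 'rV[R]_n.+1) + x *: delta_mx 0 0 by [].
  apply/rowP => k; case: (unliftP 0 k) => [l|] ->.
    by rewrite row_mx_lift [RHS]mxE row_mx_lift !mxE mulr0 addr0.
  by rewrite row_mx_ord0 [RHS]mxE row_mx_ord0 !mxE mulr1 add0r.
rewrite !volE//; apply: eq_integral => y _; exact: AB.
Qed.

End Cavalieri.

(** * Cavalieri's principle in all directions and conservation of volume by Steiner
    symmetrization *)

Section SteinerVolume.
Context {R : realType} {n : nat}.
Implicit Types (x y u v w : 'rV[R]_n) (A B C : set 'rV[R]_n).

(** Stated direction by direction so that it can be transported: known along the axes, it reaches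
    slanted directions by shears, each of which preserves volume by the principle along an axis. *)
Definition cavalieri_along v := forall A B, closed A -> closed B ->
  (forall x, line_length v A x = line_length v B x) -> volume A = volume B.

Lemma cavalieri_along_coord i : cavalieri_along (delta_mx 0 i).
Proof. by move=> A B cA cB; apply: cavalieri => //; exact: closed_borel. Qed.

(* The shear [sh] maps the direction [w] to [w + c e_j], and it preserves the
   volume because it translates every line parallel to [e_j]. *)
Lemma cavalieri_along_shear i j w (c : R) : j != i -> w 0 i = 1 ->
  cavalieri_along w -> cavalieri_along (w + c *: delta_mx 0 j).
Proof.
move=> ji wi Cw A B cA cB AB.
pose sh x := x + (c * x 0 i) *: delta_mx 0 j : 'rV[R]_n.
have csh : continuous sh.
  move=> x; apply: (@cvgD _ _ _ (nbhs x)); first exact: cvg_id.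
  apply: (@cvgZ _ _ _ (nbhs x)); last exact: cvg_cst.
  by apply: (@cvgM _ _ (nbhs x)); [exact: cvg_cst|exact: coord_continuous].
have clsh C : closed C -> closed (sh @^-1` C).
  by move=> cC; apply: preimage_closed => // x _; exact: csh.
have shE C : closed C -> volume (sh @^-1` C) = volume C.
  move=> cC; apply: (@cavalieri_along_coord j) => //; first exact: clsh.
  move=> x; rewrite -(line_length_shift _ x (c * x 0 i) cC).
  congr (lebesgue_measure _); apply/funext => t /=; congr C.
  by rewrite /sh !mxE eq_sym (negbTE ji) /= mulr0 addr0 addrAC.
rewrite -(shE A cA) -(shE B cB); apply: Cw; [exact: clsh|exact: clsh|].
have shw C x : line_length w (sh @^-1` C) x = line_length (w + c *: delta_mx 0 j) C (sh x).
  congr (lebesgue_measure _); apply/funext => t /=; congr C.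
  rewrite /sh !mxE wi mulr1; apply/rowP => k; rewrite !mxE.
  by ring.
by move=> x; rewrite !shw.
Qed.

Lemma cavalieri_along_normalized i v : v 0 i = 1 -> cavalieri_along v.
Proof.
move=> vi.
pose w (k : nat) : 'rV[R]_n := \row_j (if (j == i) || (j < k)%N then v 0 j else 0).
have wi k : w k 0 i = 1 by rewrite mxE eqxx.
suff H k : cavalieri_along (w k).
  have -> : v = w n by apply/rowP => j; rewrite mxE ltn_ord orbT.
  exact: H.
elim: k => [|k IHk].
  have -> : w 0%N = delta_mx 0 i.
    apply/rowP => j; rewrite !mxE eqxx /= orbF.
    by case: eqVneq => [->|].
  exact: cavalieri_along_coord.
have [kn|nk] := ltnP k n; last first.
  rewrite (_ : w k.+1 = w k)//; apply/rowP => j; rewrite !mxE.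
  by rewrite !(leq_trans (ltn_ord j))// (leq_trans nk).
have [ki|ki] := eqVneq (Ordinal kn) i.
  rewrite (_ : w k.+1 = w k)//; apply/rowP => j; rewrite !mxE ltnS leq_eqVlt.
  by rewrite -ki -val_eqE /=; case: eqVneq.
have -> : w k.+1 = w k + v 0 (Ordinal kn) *: delta_mx 0 (Ordinal kn).
  apply/rowP => j; rewrite !mxE eqxx /= ltnS leq_eqVlt -(val_eqE j (Ordinal kn)) /=.
  have [jk|jk] := eqVneq (j : nat) k.
    have -> : j = Ordinal kn by apply/val_inj.
    by rewrite (negbTE ki) /= ltnn add0r mulr1.
  by rewrite mulr0 addr0.
apply: cavalieri_along_shear => //; exact: ki.
Qed.

Lemma volume_steiner u A : sphere R n u -> cvx A -> compact A ->
  volume (steiner_sym u A) = volume A.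
Proof.
move=> u1 cA kA.
have [i ui] : exists i, u 0 i != 0.
  apply/existsP; rewrite -negb_forall; apply/negP => /forallP u0.
  have : u = 0 by apply/rowP => j; rewrite mxE; exact/eqP.
  by move=> u00; move: (sphereP u1); rewrite u00 dot0l => /eqP; rewrite eq_sym oner_eq0.
have v1 : ((u 0 i)^-1 *: u) 0 i = 1 by rewrite mxE mulVf.
apply: (cavalieri_along_normalized v1).
- by apply: rV_closed; rewrite steiner_symE//; exact: psym_compact.
- exact: rV_closed.
move=> x; set v := _ *: u.
have uE t : t *: u = (t * u 0 i) *: v by rewrite scalerA -mulrA divff ?mulr1.
have vE t : t *: v = (t / u 0 i) *: u by rewrite scalerA.
(* On the line through [x] the symmetral is [A] translated by [- m *: u]. If the line misses [A],
   [m] is a default value, but both sets are then empty on that line. *)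
pose m := chord_midpoint u A x.
rewrite -(line_length_shift _ x (m * u 0 i) (rV_closed kA)).
congr (lebesgue_measure _); apply/funext => t /=; rewrite propeqE; split.
  move=> [a Aa E].
  have aE : a = x + t *: v + chord_midpoint u A a *: u by rewrite -E subrK.
  have mE : chord_midpoint u A a = m.
    by rewrite aE vE -addrA -scalerDl chord_midpoint_shift.
  by move: Aa; rewrite {1}aE mE uE addrAC.
rewrite addrAC -uE => Aa; exists (x + t *: v + m *: u) => //.
have -> : chord_midpoint u A (x + t *: v + m *: u) = m.
  by rewrite vE -addrA -scalerDl chord_midpoint_shift.
by rewrite addrK.
Qed.

End SteinerVolume.

(** * Volume radius *)

Section VolumeRadius.
Context {R : realType} {d : nat}.
Implicit Types (x y u v w : 'rV[R]_d) (A B C K : set 'rV[R]_d) (r e : R).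

Definition vol A : R := fine (volume A).

Lemma volumeE A : compact A -> volume A = (vol A)%:E.
Proof.
move=> cA; have [M M0 AM] := compact_enorm cA.
have [mu muE] := @volume_measure R d.
have mA := compact_borel cA; have mC := @cube_measurable R d M (ltW M0).
rewrite /vol fineK// muE// ge0_fin_numE ?measure_ge0//.
apply: (@le_lt_trans _ _ (mu (@cube R d M))).
  apply: le_measure; rewrite ?inE// => x /AM xM i.
  exact: le_trans (norm_entry _ _) (le_trans (norm_le_enorm _) xM).
by rewrite -muE// volume_cube ?ltry// ltW.
Qed.

Lemma vol_le A B : compact A -> compact B -> A `<=` B -> vol A <= vol B.
Proof.
move=> cA cB AB; rewrite -lee_fin -!volumeE//.
have [mu muE] := @volume_measure R d.
rewrite !muE; [|exact: compact_borel|exact: compact_borel].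
by apply: le_measure; rewrite ?inE//; exact: compact_borel.
Qed.

Lemma vol_disjoint A B C : compact A -> compact B -> compact C ->
  A `<=` C -> B `<=` C -> (forall x, A x -> B x -> False) ->
  vol A + vol B <= vol C.
Proof.
move=> cA cB cC AC BC AB; rewrite -lee_fin EFinD -!volumeE//.
have [mu muE] := @volume_measure R d.
have mA := compact_borel cA; have mB := compact_borel cB; have mC := compact_borel cC.
rewrite !muE// -measureU//; last by apply/seteqP; split=> // x [] /AB.
apply: le_measure; rewrite ?inE//; first exact: measurableU.
by move=> x [/AC|/BC].
Qed.

Definition kappa := vol (cball 0 1).

Lemma kappa_gt0 : 0 < kappa.
Proof.
have D0 : 0 < d%:R + 1 :> R by rewrite ltr_wpDl.
have a0 : 0 < (d%:R + 1)^-1 :> R by rewrite invr_gt0.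
(* The cube of half-side [1 / (d + 1)] fits in the unit ball since [enorm] is at most [d + 1] times
   the sup norm. *)
apply: (@lt_le_trans _ _ (((d%:R + 1)^-1 *+ 2) ^+ d)).
  by rewrite exprn_gt0// mulrn_wgt0.
have cc := @cball_compact R d 0 1.
rewrite -lee_fin -volumeE// -volume_cube; last exact: ltW.
have [mu muE] := @volume_measure R d.
have mC := @cube_measurable R d _ (ltW a0).
have mB := compact_borel cc.
rewrite !muE//; apply: le_measure; rewrite ?inE// => x.
rewrite cubeE; last exact: ltW.
rewrite /cball /= subr0 => xa.
apply: le_trans (enorm_le_norm _) _.
by rewrite -ler_pdivlMl// mulr1.
Qed.

Lemma vol_cball x r : 0 < r -> vol (cball x r) = r ^+ d * kappa.
Proof.
move=> r0; have ri0 : 0 < r^-1 by rewrite invr_gt0.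
have E : cball x r = [set z | cball 0 1 (r^-1 *: z + - (r^-1 *: x))].
  apply/funext => z; rewrite /cball /= subr0 -scalerBr enormZ gtr0_norm//.
  by rewrite mulrC ler_pdivrMr// mul1r.
have mB := compact_borel (@cball_compact R d 0 1).
apply: EFin_inj; rewrite -volumeE; last exact: cball_compact.
rewrite E volume_affine// invrK volumeE ?EFinM//; exact: cball_compact.
Qed.

Lemma vol_body_gt0 A : body A -> 0 < vol A.
Proof.
move=> [_ kA [c [r [r0 rA]]]]; apply: lt_le_trans (vol_le _ kA rA).
  by rewrite vol_cball// mulr_gt0 ?exprn_gt0// kappa_gt0.
exact: cball_compact.
Qed.

Hypothesis d0 : (0 < d)%N.

Lemma volume_radiusP A : body A ->
  0 < volume_radius A /\ vol A = volume_radius A ^+ d * kappa.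
Proof.
move=> bA; have kA : compact A by case: bA.
have v0 := vol_body_gt0 bA.
have : exists r, 0 < r /\ volume (dilate r (unit_ball R d)) = volume A.
  pose r := (vol A / kappa) `^ (d%:R^-1).
  have q0 : 0 < vol A / kappa by rewrite divr_gt0// kappa_gt0.
  have r0 : 0 < r by exact: powR_gt0.
  exists r; split => //; rewrite dilate_unit_ball ?ltW// !volumeE//; last exact: cball_compact.
  congr EFin; rewrite vol_cball// -powR_mulrn ?powR_ge0// -powRrM mulVf ?powRr1.
  - by rewrite divfK// gt_eqF// kappa_gt0.
  - exact: ltW.
  - by rewrite pnatr_eq0 -lt0n.
rewrite /volume_radius => /getPex; set r := get _ => -[r0].
rewrite dilate_unit_ball ?ltW// !volumeE//; last exact: cball_compact.
by move=> [<-]; rewrite vol_cball.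
Qed.

Lemma volume_radius_gt0 A : body A -> 0 < volume_radius A.
Proof. by move/volume_radiusP => []. Qed.

Lemma vol_volume_radius A : body A -> vol A = volume_radius A ^+ d * kappa.
Proof. by move/volume_radiusP => []. Qed.

Lemma volume_radius_le A r : body A -> 0 <= r -> vol A <= r ^+ d * kappa ->
  volume_radius A <= r.
Proof.
move=> bA r0; rewrite vol_volume_radius// ler_pM2r ?kappa_gt0//.
by rewrite ler_pXn2r ?nnegrE// ltW// volume_radius_gt0.
Qed.

Lemma volume_radius_ge A r : body A -> 0 <= r -> r ^+ d * kappa <= vol A ->
  r <= volume_radius A.
Proof.
move=> bA r0; rewrite vol_volume_radius// ler_pM2r ?kappa_gt0//.
by rewrite ler_pXn2r ?nnegrE// ltW// volume_radius_gt0.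
Qed.

Lemma exprn_near r e : 0 < e -> exists2 s, 0 < s & forall t, `|t - r| <= s ->
  `|t ^+ d - r ^+ d| < e.
Proof.
move=> e0; have := @exprn_continuous R d r.
move=> /(@cvgrPdist_lt _ _ _ (nbhs r)) /(_ e e0) /nbhs_ballP[s /= s0 H].
exists (s / 2); first exact: divr_gt0.
move=> t ts; rewrite distrC; apply: H; rewrite /ball /= distrC; lra.
Qed.

(** If the support function fell below [r - e] at [x], the ball of radius [f / 4] about
    [(r - f / 2) *: x] would lie in the enlarged ball and miss [K], costing a fixed volume; [s] is
    so small that the enlargement gains less. The bound [f <= r] keeps the centre on the side of
    [x]. *)
Lemma volume_inside r e : 0 < r -> 0 < e -> exists2 s, 0 < s &
  forall K, body K -> K `<=` cball 0 (r + s) -> vol K = r ^+ d * kappa ->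
  forall x, sphere R d x -> r - e <= support_fun K x.
Proof.
move=> r0 e0; pose f := Num.min e r.
have f0 : 0 < f by rewrite lt_min e0.
have fe : f <= e by rewrite ge_min lexx.
have fr : f <= r by rewrite ge_min lexx orbT.
have c0 : 0 < (f / 4) ^+ d by rewrite exprn_gt0// divr_gt0.
have [s s0 H] := exprn_near r c0; exists s => // K bK Ks vK x x1.
have kK : compact K by case: bK.
rewrite leNgt; apply/negP => fK.
have f4 : 0 < f / 4 by rewrite divr_gt0.
have := @vol_disjoint K (cball ((r - f / 2) *: x) (f / 4)) (cball 0 (r + s)) kK
  (@cball_compact _ _ _ _) (@cball_compact _ _ _ _) Ks.
rewrite !vol_cball ?addr_gt0// vK -mulrDl ler_pM2r ?kappa_gt0//.
have := H (r + s); rewrite addrAC subrr add0r gtr0_norm// => /(_ (lexx _)).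
rewrite ltr_norml => /andP[_ H1] H2.
suff : r ^+ d + (f / 4) ^+ d <= (r + s) ^+ d by lra.
apply: H2 => y; rewrite /cball /= ?subr0.
  have := enormD (y - (r - f / 2) *: x) ((r - f / 2) *: x); rewrite subrK.
  by rewrite enormZ (_ : enorm x = 1)// mulr1 ger0_norm; lra.
move=> Ky; have := support_fun_ge x kK Ky.
have := dot_le ((r - f / 2) *: x - y) x.
rewrite (_ : enorm x = 1)// mulr1 enormBC !dotL sphereP//; lra.
Qed.

(** If the support function exceeded [r + e] at [x], convexity would put in [K] a small ball
    disjoint from the one of radius [r - s]: the centred ball of radius [r / 2], shrunk with ratio
    [t] towards a point [z] of height [r + e]. The total volume would then be too large. *)
Lemma volume_outside r e : 0 < r -> 0 < e -> exists2 s, 0 < s &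
  forall K, body K -> cball 0 (r - s) `<=` K -> vol K <= r ^+ d * kappa ->
  forall x, sphere R d x -> support_fun K x <= r + e.
Proof.
(* With this [t] the small ball lies at height at least [(1 - t) * (r + e) - t * (r / 2) = r + e /
   2]. *)
move=> r0 e0; pose t := e / (3 * r + 2 * e).
have D0 : 0 < 3 * r + 2 * e by lra.
have t0 : 0 < t by rewrite divr_gt0.
have tD : t * (3 * r + 2 * e) = e by rewrite divfK// gt_eqF.
have t1 : t <= 1 by rewrite /t ler_pdivrMr// mul1r; lra.
have c0 : 0 < (t * (r / 2)) ^+ d by rewrite exprn_gt0// mulr_gt0// divr_gt0.
have [s0 s00 H] := exprn_near r c0; pose s := Num.min s0 (r / 2).
have ss0 : s <= s0 by rewrite ge_min lexx.
have sr : s <= r / 2 by rewrite ge_min lexx orbT.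
have s1 : 0 < s by rewrite lt_min s00 divr_gt0.
exists s => // K bK sK vK x x1.
have [cK kK _] := bK.
have [y Ky ->] := support_funP x (body_nonempty bK) kK.
rewrite leNgt; apply/negP => yx.
have h0 : 0 < dot y x by apply: lt_trans yx; lra.
have Kr v : enorm v <= r / 2 -> K v.
  by move=> vr; apply: sK; rewrite /cball /= subr0; lra.
have [z Kz zx] : exists2 z, K z & dot z x = r + e.
  exists (((r + e) / dot y x) *: y); last by rewrite dotZl divfK// gt_eqF.
  have K0 : K 0 by apply: Kr; rewrite enorm0 divr_ge0// ltW.
  have q01 : 0 <= (r + e) / dot y x <= 1.
    rewrite divr_ge0 ?(ltW h0)//=; last by lra.
    by rewrite ler_pdivrMr// mul1r ltW.
  by have := cK _ _ _ Ky K0 q01; rewrite scaler0 addr0.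
have Bsub : cball ((1 - t) *: z) (t * (r / 2)) `<=` K.
  move=> v; rewrite /cball /= => vz.
  have -> : v = t *: (t^-1 *: (v - (1 - t) *: z)) + (1 - t) *: z.
    by rewrite scalerA divff ?gt_eqF// scale1r subrK.
  apply: cK => //; last by rewrite ltW.
  by apply: Kr; rewrite enormZ gtr0_norm ?invr_gt0// ler_pdivrMl.
have := @vol_disjoint (cball 0 (r - s)) _ K (@cball_compact _ _ _ _)
  (@cball_compact _ _ _ _) kK sK Bsub.
have tr0 : 0 < t * (r / 2) by rewrite mulr_gt0// divr_gt0.
have rs0 : 0 < r - s by lra.
rewrite !vol_cball// -mulrDl => H2.
have := H (r - s); rewrite addrAC subrr add0r normrN gtr0_norm// => /(_ ss0).
rewrite ltr_norml => /andP[H1 _].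
suff : ((r - s) ^+ d + (t * (r / 2)) ^+ d) * kappa <= r ^+ d * kappa.
  by rewrite ler_pM2r ?kappa_gt0//; lra.
apply: le_trans vK; apply: H2 => v; rewrite /cball /= subr0 => vr vz.
have := dot_le v x; have := dot_le ((1 - t) *: z - v) x.
rewrite (_ : enorm x = 1)// !mulr1 enormBC !dotL zx; nra.
Qed.

End VolumeRadius.

(** * Mean radius *)

Lemma continuous_borel (R : realType) d (f : 'rV[R]_d -> R) : continuous f ->
  measurable_fun setT (f : borel_rV R d -> R).
Proof.
move=> cf; apply: (measurability _ (RGenOpens.measurableE R)).
move=> _ [_ [a [b ->] <-]]; rewrite setTI; apply: sub_sigma_algebra.
by apply: open_comp => [x _|]; [exact: cf|exact: interval_open].
Qed.

Lemma continuous_borel_rV (R : realType) d (f : 'rV[R]_d -> 'rV[R]_d) : continuous f ->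
  measurable_fun setT (f : borel_rV R d -> borel_rV R d).
Proof.
move=> cf.
have H := @measurability _ _ _ _ setT (f : borel_rV R d -> borel_rV R d)
  (@open 'rV[R]_d) erefl.
apply: H => _ [W oW <-]; rewrite setTI; apply: sub_sigma_algebra.
by apply: open_comp => // x _; exact: cf.
Qed.

Lemma enorm_orth (R : realType) d (Q : 'M[R]_d) (x : 'rV[R]_d) :
  Q *m Q^T = 1%:M -> enorm (x *m Q) = enorm x.
Proof.
by move=> QQ; rewrite /enorm /dot trmx_mul mulmxA -(mulmxA x) QQ mulmx1.
Qed.

Lemma orth_continuous (R : realType) d (Q : 'M[R]_d) :
  Q *m Q^T = 1%:M -> continuous (fun x : 'rV[R]_d => x *m Q).
Proof.
move=> QQ x V /nbhs_enormP[e e0 eV]; apply/nbhs_enormP; exists e => // y xy.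
by apply: eV; rewrite -mulmxBl enorm_orth.
Qed.

Section MeanRadius.
Context {R : realType} {d : nat}.
Variable sigma : probability (borel_rV R d) R.
Hypothesis sigma_inv : rotation_invariant sigma.
Implicit Types (x y u v w : 'rV[R]_d) (A B C K : set 'rV[R]_d) (r e c : R)
  (f g : 'rV[R]_d -> R).
Local Notation S := (sphere R d).

Lemma sphere_closed : closed S.
Proof.
apply: (@preimage_closed _ _ (@enorm R d) [set t | t = 1]).
  by move=> x _; exact: enorm_continuous.
exact: closed_eq.
Qed.

Lemma sphere_compact : compact S.
Proof.
apply: bounded_closed_compact; last exact: sphere_closed.
by apply: (@bounded_enorm _ _ _ 1) => x; rewrite /sphere /= => ->.
Qed.

Lemma sphere_borel : measurable (S : set (borel_rV R d)).
Proof. exact: closed_borel sphere_closed. Qed.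

Let sigmaS : sigma S = 1%E. Proof. by case: sigma_inv. Qed.

Definition mean (f : 'rV[R]_d -> R) : R := Rintegral sigma S f.

Lemma continuous_integrable (f : 'rV[R]_d -> R) : continuous f ->
  sigma.-integrable S (EFin \o f).
Proof.
move=> cf; apply: measurable_bounded_integrable.
- exact: sphere_borel.
- exact: le_lt_trans (probability_le1 sigma sphere_borel) (ltry 1).
- by apply: measurable_funTS; exact: continuous_borel.
have cfS : compact (f @` S).
  by apply: continuous_compact sphere_compact; exact: continuous_subspaceT.
have [M [_ MfS]] := compact_bounded cfS.
exists M; split; first exact: num_real.
by move=> N MN x Sx; apply: (MfS N MN); exists x.
Qed.

Lemma mean_cst c : mean (fun=> c) = c.
Proof.
rewrite /mean Rintegral_cst; last exact: sphere_borel.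
by rewrite (_ : fine _ = 1) ?mulr1// -[RHS]/(fine 1%E) -sigmaS.
Qed.

Lemma cst_continuous_rV c : continuous (fun _ : 'rV[R]_d => c).
Proof. exact: cst_continuous. Qed.

Lemma mean_le f g : continuous f -> continuous g ->
  (forall x, S x -> f x <= g x) -> mean f <= mean g.
Proof.
move=> cf cg; apply: (@le_Rintegral _ _ _ sigma S f g);
  [exact: sphere_borel|exact: continuous_integrable..].
Qed.

Lemma meanD f g : continuous f -> continuous g ->
  mean (fun x => f x + g x) = mean f + mean g.
Proof.
move=> cf cg; apply: (@RintegralD _ _ _ sigma S f g);
  [exact: sphere_borel|exact: continuous_integrable..].
Qed.

Lemma meanZ c f : continuous f -> mean (fun x => c * f x) = c * mean f.
Proof.
move=> cf; apply: (@RintegralZl _ _ _ sigma S f c);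
  [exact: sphere_borel|exact: continuous_integrable].
Qed.

Lemma mean_orth (Q : 'M[R]_d) f : continuous f -> Q *m Q^T = 1%:M ->
  mean (fun x => f (x *m Q)) = mean f.
Proof.
move=> cf QQ; pose phi : borel_rV R d -> borel_rV R d := fun x => x *m Q.
have cphi := orth_continuous QQ.
have mphi : measurable_fun setT phi by exact: continuous_borel_rV.
have phiS : phi @^-1` S = S.
  by apply/funext => x; rewrite /phi /sphere /= enorm_orth.
have cfphi : continuous (f \o phi).
  by move=> x; apply: continuous_comp; [exact: cphi|exact: cf].
have mS := sphere_borel.
rewrite /mean /Rintegral; congr fine.
have intf : sigma.-integrable (phi @^-1` S) ((EFin \o f) \o phi).
  by rewrite phiS; exact: continuous_integrable.
have mf : measurable_fun setT (EFin \o f : borel_rV R d -> \bar R).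
  by apply/measurable_EFinP; exact: continuous_borel.
have := integral_pushforward mphi mf intf mS; rewrite phiS => /esym H.
transitivity (\int[pushforward sigma phi]_(y in S) (f y)%:E)%E; first exact: H.
apply: (@eq_measure_integral _ (borel_rV R d) R S sigma
  (measure_function_pushforward__canonical__measure_function_Measure sigma mphi)).
by move=> E mE _; case: sigma_inv => _; exact.
Qed.

Lemma support_fun_continuous A : A !=set0 -> compact A -> continuous (support_fun A).
Proof.
move=> A0 cA x; have [M M0 AM] := compact_enorm cA.
apply/(@cvgrPdist_lt _ _ _ (nbhs x)) => e e0.
near=> y; apply: (@le_lt_trans _ _ (M * enorm (x - y))).
  have := support_fun_lip x y A0 cA AM; have := support_fun_lip y x A0 cA AM.
  by rewrite (enormBC y) ler_norml; lra.
rewrite -ltr_pdivlMl//; near: y; apply: enorm_lt_nbhs; rewrite mulr_gt0// invr_gt0//.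
Unshelve. all: by end_near. Qed.

Lemma mean_radius_ge A c : A !=set0 -> compact A ->
  (forall x, S x -> c <= support_fun A x) -> c <= mean_radius sigma A.
Proof.
move=> A0 cA H; rewrite -[leLHS]mean_cst; apply: mean_le => //.
  exact: cst_continuous_rV.
exact: support_fun_continuous.
Qed.

Lemma mean_radius_le A c : A !=set0 -> compact A ->
  (forall x, S x -> support_fun A x <= c) -> mean_radius sigma A <= c.
Proof.
move=> A0 cA H; rewrite -[leRHS]mean_cst; apply: mean_le => //.
  exact: support_fun_continuous.
exact: cst_continuous_rV.
Qed.

Lemma mean_radius_leD A B c : A !=set0 -> compact A -> B !=set0 -> compact B ->
  (forall x, S x -> support_fun A x <= support_fun B x + c) ->
  mean_radius sigma A <= mean_radius sigma B + c.
Proof.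
move=> A0 cA B0 cB H.
rewrite -[X in _ <= _ + X]mean_cst -meanD; [|exact: support_fun_continuous|exact: cst_continuous_rV].
apply: mean_le => //; first exact: support_fun_continuous.
by move=> x; apply: (@cvgD _ _ _ (nbhs x));
  [exact: (support_fun_continuous B0 cB)|exact: cst_continuous_rV].
Qed.

(** The support function of the symmetral averages [support_fun A] with its composite with an
    orthogonal map. *)
Lemma mean_radius_minkowski u A : S u -> A !=set0 -> compact A ->
  mean_radius sigma (psym false u A) = mean_radius sigma A.
Proof.
move=> u1 A0 cA; have cf := support_fun_continuous A0 cA.
have cg : continuous (fun x => support_fun A (x *m reflection_mx u)).
  move=> x; apply: (@continuous_comp _ _ _ (fun x : 'rV[R]_d => x *m reflection_mx u)).
    exact: orth_continuous (reflection_mx_orth u1) _.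
  exact: cf.
rewrite /mean_radius.
have -> : support_fun (psym false u A) = fun x => 2^-1 *
    (support_fun A x + support_fun A (x *m reflection_mx u)).
  by apply/funext => x; rewrite support_fun_minkowski// mul_reflection_mx.
rewrite -/(mean _) meanZ; last first.
  by move=> x; apply: (@cvgD _ _ _ (nbhs x)); [exact: cf|exact: cg].
rewrite meanD// mean_orth//; last exact: reflection_mx_orth.
by rewrite -/(mean _); field.
Qed.

(** The support function may be negative when the origin is outside [A]; pairing [x] with [- x], an
    orthogonal map, gives the width, which is nonnegative. *)
Lemma mean_radius_ge0 A : A !=set0 -> compact A -> 0 <= mean_radius sigma A.
Proof.
move=> A0 cA; have cf := support_fun_continuous A0 cA.
have QQ : (- 1%:M : 'M[R]_d) *m (- 1%:M)^T = 1%:M.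
  by rewrite linearN /= trmx1 mulNmx mulmxN mul1mx opprK.
have cg : continuous (fun x => support_fun A (x *m - 1%:M)).
  move=> x; apply: (@continuous_comp _ _ _ (fun x : 'rV[R]_d => x *m - 1%:M)).
    exact: orth_continuous QQ _.
  exact: cf.
suff : 0 <= mean (support_fun A) + mean (support_fun A) by rewrite /mean /mean_radius; lra.
rewrite -{2}(mean_orth cf QQ) -meanD// -(mean_cst 0); apply: mean_le.
- exact: cst_continuous_rV.
- by move=> x; apply: (@cvgD _ _ _ (nbhs x)); [exact: cf|exact: cg].
move=> x _; rewrite mulmxN mulmx1; case: A0 => y Ay.
have := support_fun_ge x cA Ay; have := support_fun_ge (- x) cA Ay.
rewrite dotNr; lra.
Qed.

Definition cap x e : set 'rV[R]_d := [set y | enorm (y - x) < e] `&` S.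

Lemma ball_open_enorm x e : open [set y | enorm (y - x) < e].
Proof.
apply: (@open_comp _ _ (fun y => enorm (y - x)) [set t | t < e]); last exact: open_lt.
by move=> y _; exact: edist_continuous.
Qed.

Lemma cap_borel x e : measurable (cap x e : set (borel_rV R d)).
Proof.
apply: measurableI; last exact: sphere_borel.
by apply: sub_sigma_algebra; exact: ball_open_enorm.
Qed.

Lemma cap_measure x y e : S x -> S y -> sigma (cap x e) = sigma (cap y e).
Proof.
move=> x1 y1; have [->//|xy] := eqVneq x y.
have [u u1 uxy] := reflection_transitive x1 y1 xy.
case: sigma_inv => _ /(_ (reflection_mx u) (cap y e) (reflection_mx_orth u1) (cap_borel y e)) <-.
congr (sigma _); apply/funext => z; rewrite /cap /= mul_reflection_mx /sphere /=.
by rewrite enorm_reflection// -uxy -reflectionN -reflectionD enorm_reflection.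
Qed.

(** Finitely many caps of radius [e] cover the compact sphere, and all have the same measure; were
    it zero, the sphere would be null. *)
Lemma cap_measure_gt0 e : 0 < e -> exists2 c, 0 < c &
  forall x, S x -> c <= fine (sigma (cap x e)).
Proof.
move=> e0.
have [x0 Sx0] : S !=set0.
  apply/set0P/eqP => S0; have := sigmaS; rewrite S0 measure0 => /eqP.
  by rewrite eq_sym onee_eq0.
exists (fine (sigma (cap x0 e))); last by move=> x Sx; rewrite (cap_measure e Sx0 Sx).
have fin : sigma (cap x0 e) \is a fin_num by exact: fin_num_measure (cap_borel _ _).
rewrite lt_neqAle fine_ge0// andbT; apply/eqP => /esym c0.
have z x : S x -> sigma (cap x e) = 0%E.
  by move=> Sx; rewrite (cap_measure e Sx Sx0) -(fineK fin) c0.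
have := sphere_compact; rewrite compact_cover => /(_ _ S (fun x => [set y | enorm (y - x) < e])).
case=> [x _|x Sx|D DS SD]; first exact: ball_open_enorm.
  by exists x => //; rewrite /= subrr enorm0.
have SD' : S `<=` \bigcup_(x in [set` D]) cap x e.
  by move=> x Sx; have [y Dy xy] := SD x Sx; exists y.
have := @content_sub_fsum _ _ _ sigma _ [set` D] S (fun x => cap x e)
  (finite_fset D) (fun x _ => cap_borel x e) sphere_borel SD'.
rewrite fsbig1 => [|x /DS]; last by rewrite inE; exact: z.
by move: sigmaS => /= -> ; rewrite lee_fin ler10.
Qed.

(** A dip of the support function below [r - e] at [x] persists, by the Lipschitz bound, on a cap
    about [x] whose measure is bounded below independently of [x]. Elsewhere the function is at most
    [r + s], so the mean would fall below [r]. *)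
Lemma mean_radius_inside r e : 0 <= r -> 0 < e -> exists2 s, 0 < s &
  forall K, body K -> K `<=` cball 0 (r + s) -> r <= mean_radius sigma K ->
  forall x, S x -> r - e <= support_fun K x.
Proof.
move=> r0 e0; have M0 : 0 < r + 1 by lra.
(* Since [s <= 1], the points of [K] have norm at most [r + 1], which is thus a Lipschitz constant;
   on a cap of this radius the support function rises by at most [e / 2]. *)
have a0 : 0 < e / 2 / (r + 1) by rewrite !divr_gt0.
have [c c0 cP] := cap_measure_gt0 a0.
(* The cap costs at least [e / 2 * c], twice what [s] may gain. *)
pose s := Num.min 1 (e / 4 * c).
have s0 : 0 < s by rewrite lt_min ltr01 mulr_gt0// divr_gt0.
have s1 : s <= 1 by rewrite ge_min lexx.
have sc : s <= e / 4 * c by rewrite ge_min lexx orbT.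
exists s => // K bK Ks rK x x1.
have [_ kK _] := bK; have K0 := body_nonempty bK.
rewrite leNgt; apply/negP => fx.
have KM y : K y -> enorm y <= r + 1.
  by move/Ks; rewrite /cball /= subr0; lra.
pose g (y : 'rV[R]_d) : R := (r + s) - e / 2 * \1_(cap x (e / 2 / (r + 1))) y.
have mS := sphere_borel; have mcap := cap_borel x (e / 2 / (r + 1)).
have int_cst : sigma.-integrable S (EFin \o (fun=> r + s)).
  by apply: continuous_integrable; exact: cst_continuous_rV.
have int_1 : sigma.-integrable S (EFin \o \1_(cap x (e / 2 / (r + 1)))).
  by apply: integrableS (integrable_indic _ mcap).
have int_2 : sigma.-integrable S (EFin \o (fun y => e / 2 * \1_(cap x (e / 2 / (r + 1))) y)).
  exact: (integrableZl mS (e / 2) int_1).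
have : mean (support_fun K) <= mean g.
  apply: (@le_Rintegral _ _ _ sigma S (support_fun K) g) => //.
  - by apply: continuous_integrable; exact: support_fun_continuous.
  - exact: (integrableB mS int_cst int_2).
  move=> y y1; rewrite /g indicE; case: (boolP (y \in _)) => /=.
    rewrite inE => -[/= yx _]; have := support_fun_lip y x K0 kK KM.
    have : (r + 1) * enorm (y - x) <= e / 2.
      by rewrite mulrC -ler_pdivlMr// ltW.
    by lra.
  rewrite mulr0 subr0 => _; exact: (support_fun_le_cball K0 kK Ks y1).
rewrite /mean (@RintegralB _ _ _ sigma S _ _ mS int_cst int_2).
rewrite (@RintegralZl _ _ _ sigma S _ _ mS int_1).
have mc := mean_cst (r + s); rewrite /mean in mc; rewrite {}mc.
rewrite /Rintegral integral_indic//.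
rewrite (_ : _ `&` S = cap x (e / 2 / (r + 1))); last first.
  by rewrite setIidl// => y [].
have := cP x x1; move: rK; rewrite /mean_radius /Rintegral.
by nra.
Qed.

End MeanRadius.

(** * Measurability of the rounding events *)

Section SequenceEvents.
Context {R : realType} {d : nat}.
Local Notation V := (borel_rV R d).

Definition coordinate_sets : set (set (nat -> V)) :=
  \bigcup_n preimage_set_system [set: nat -> V] (fun x => x n) measurable.

Local Notation seqV := (g_sigma_algebraType coordinate_sets).

Lemma rat_dense_enorm (x : 'rV[R]_d) (e : R) : 0 < e ->
  exists q : 'rV[rat]_d, enorm (x - map_mx ratr q) < e.
Proof.
move=> e0; have D0 : 0 < (d%:R + 1 : R) by rewrite ltr_wpDl.
have [q qx] := rat_dense_rV x (divr_gt0 e0 D0); exists q.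
apply: le_lt_trans (enorm_le_norm _) _.
by rewrite mulrC -ltr_pdivlMr.
Qed.

(** The hypothesis is openness for the product topology; finite lists of rational points with radii
    [1 / (k + 1)] form a countable base of cylinders. *)
Lemma cylinder_measurable (W : set (nat -> 'rV[R]_d)) :
  (forall x, W x -> exists n (e : R), 0 < e /\
    forall y, (forall i, (i < n)%N -> enorm (x i - y i) < e) -> W y) ->
  measurable (W : set seqV).
Proof.
move=> WP.
pose q (s : seq 'rV[rat]_d) i : 'rV[R]_d := map_mx ratr (nth 0 s i).
pose B (j : nat * seq 'rV[rat]_d) : set seqV := [set y : nat -> 'rV[R]_d |
  forall i, (i < size j.2)%N -> enorm (y i - q j.2 i) < j.1.+1%:R^-1].
apply: (@measurable_countable_base _ _ _ B) => [[k s]|x Wx].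
  have -> : B (k, s) = \bigcap_i (if (i < size s)%N then
      [set y : nat -> 'rV[R]_d | enorm (y i - q s i) < k.+1%:R^-1] else setT).
    apply/seteqP; split=> y By i => [_|si].
      by case: ifP => // si; exact: By.
    by have := By i I; rewrite si.
  apply: bigcapT_measurable => i; case: ifP => // _.
  apply: sub_sigma_algebra; exists i => //=.
  exists [set z : 'rV[R]_d | enorm (z - q s i) < k.+1%:R^-1]; last by rewrite setTI.
  by apply: sub_sigma_algebra; exact: ball_open_enorm.
have [n [e [e0 We]]] := WP x Wx.
have [k] : exists k, 0 + k.+1%:R^-1 < e / 2 by apply: ltr_add_invr; rewrite divr_gt0.
rewrite add0r => ke.
have k0 : 0 < k.+1%:R^-1 :> R by rewrite invr_gt0.
have /choice[f fP] i := rat_dense_enorm (x i) k0.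
have qE i : (i < n)%N -> q (mkseq f n) i = map_mx ratr (f i).
  by move=> ni; rewrite /q nth_mkseq.
exists (k, mkseq f n) => [|y]; rewrite /B /= size_map size_iota.
  by move=> i ni; rewrite qE.
move=> By; apply: We => i ni; have := By i ni; rewrite qE// enormBC => H.
apply: le_lt_trans (enorm_distD _ (map_mx ratr (f i)) _) _.
by rewrite [ltRHS]splitr ltrD// (lt_trans _ ke).
Qed.

Local Notation piter b := (iter_sym (@psym R d b)).

Lemma piter_sub_measurable b K n (G : set 'rV[R]_d) : compact K -> open G ->
  measurable ([set x : nat -> 'rV[R]_d | piter b x 0 n K `<=` G] : set seqV).
Proof.
move=> kK oG; apply: cylinder_measurable => x /= xG.
by have [e e0 H] := piter_usc kK oG xG; exists n, e.
Qed.

(** The inclusion in an open ball bounds the support function above; its lower bound is the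
    complement of an inclusion in an open half-space. Both inclusions are open conditions on the
    directions, and the uncountable union over [v] remains open. The event ranges over all sequences
    and means rounding for unit directions ([round_eventP]). *)
Definition round_event b K (r : R) : set seqV :=
  \bigcap_m \bigcup_N \bigcap_n
    ([set x : nat -> 'rV[R]_d | piter b x 0 (N + n) K `<=`
       [set z | enorm (z - 0) < r + m.+1%:R^-1]] `&`
    ~` [set x : nat -> 'rV[R]_d | exists2 v, sphere R d v &
       piter b x 0 (N + n) K `<=` [set z | dot z v < r - m.+1%:R^-1]]).

Lemma round_event_measurable b K r : compact K -> measurable (round_event b K r).
Proof.
move=> kK; apply: bigcapT_measurable => m; apply: bigcupT_measurable => N.
apply: bigcapT_measurable => n; apply: measurableI.
  by apply: piter_sub_measurable => //; exact: ball_open_enorm.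
apply: measurableC; apply: cylinder_measurable => x /= [v v1 xv].
have oG : open [set z : 'rV[R]_d | dot z v < r - m.+1%:R^-1].
  apply: (@open_comp _ _ (fun z => dot z v) [set t | t < r - m.+1%:R^-1]); last exact: open_lt.
  by move=> y _; exact: dotr_continuous.
have [e e0 H] := piter_usc kK oG xv; exists (N + n)%N, e; split => // y xy.
by exists v => //; exact: H.
Qed.

Lemma round_eventP b K r (x : nat -> 'rV[R]_d) : (forall i, sphere R d (x i)) ->
  body K -> 0 <= r ->
  round_event b K r x <-> rounds_to (fun n => piter b x 0 n K) r.
Proof.
move=> x1 bK r0; split.
  move=> H e e0.
  have [m] : exists m, 0 + m.+1%:R^-1 < e by exact: ltr_add_invr.
  rewrite add0r => me; have [N _ HN] := H m I.
  exists N => // n /= Nn v v1; have := HN (n - N)%N I; rewrite subnKC// => -[/= H1 H2].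
  have [_ kB _] := piter_body b 0 n x1 bK; have B0 := body_nonempty (piter_body b 0 n x1 bK).
  have [y By yE] := support_funP v B0 kB.
  rewrite ler_distl; apply/andP; split.
    rewrite leNgt; apply/negP => lt; apply: H2; exists v => // z Bz /=.
    apply: le_lt_trans (support_fun_ge v kB Bz) _; apply: lt_trans lt _.
    by rewrite ltrD2l ltrN2.
  rewrite yE; have := H1 _ By; rewrite /= subr0 => ylt.
  have := dot_le y v; rewrite (_ : enorm v = 1)// mulr1 => yv.
  by rewrite (le_trans yv)// ltW// (lt_trans ylt)// ltrD2l.
move=> H m _; have: 0 < m.+1%:R^-1 :> R by rewrite invr_gt0.
(* Half of [e] leaves room for the strict inequalities of the event. *)
move: (m.+1%:R^-1 : R) => e e0; have m0 : 0 < e / 2 by rewrite divr_gt0.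
have [N _ HN] := H _ m0; exists N => // n _.
have [_ kB _] := piter_body b 0 (N + n) x1 bK; have B0 := body_nonempty (piter_body b 0 (N + n) x1 bK).
have {}HN := HN (N + n)%N (leq_addr _ _); split => /=.
  move=> y By /=; have : cball 0 (r + e / 2) y.
    apply: support_fun_le_sub By => //; first by rewrite addr_ge0// ltW.
    by move=> v v1; have := HN v v1; rewrite ler_distl => /andP[].
  rewrite /cball /= => /le_lt_trans; apply; lra.
move=> [v v1 vB]; have := HN v v1; rewrite ler_distl => /andP[+ _].
have [y By ->] := support_funP v B0 kB.
by have := vB _ By; rewrite /=; lra.
Qed.

End SequenceEvents.

(** * Transport of almost sure events by shifts *)

Section Stationary.
Context {R : realType} {d : nat} {disp : measure_display}
  {Omega : measurableType disp}.
Variables (P : probability Omega R) (U : nat -> {RV P >-> borel_rV R d}).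

Lemma seq_event_measurable k (E : set (nat -> borel_rV R d)) : seq_measurable E ->
  measurable [set w | E (fun n => U (k + n)%N w)].
Proof.
move=> mE.
have H := @measurability _ _ Omega (g_sigma_algebraType (@coordinate_sets R d)) setT
  (fun w n => U (k + n)%N w) (@coordinate_sets R d) erefl.
have := H _ measurableT E mE; rewrite setTI; apply.
move=> _ [_ [n _ [B mB <-]] <-]; rewrite !setTI.
by have := @measurable_funPT _ _ _ _ (U (k + n)%N) measurableT B mB; rewrite setTI.
Qed.

(** Stationarity compares probabilities of measurable events only; measurability of [E] turns an
    almost sure property into a null event that can be shifted. *)
Lemma stationary_ae (E : set (nat -> borel_rV R d)) : stationary U ->
  seq_measurable E -> {ae P, forall w, E (fun n => U n w)} ->
  forall k, {ae P, forall w, E (fun n => U (k + n)%N w)}.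
Proof.
move=> sU mE aE k.
have mE' : seq_measurable (~` E) by apply: (@measurableC _ (g_sigma_algebraType (@coordinate_sets R d))).
apply/(@negligibleP _ _ _ P).
  exact: (seq_event_measurable k mE').
transitivity (P [set w | (~` E) (fun n => U n w)]); first exact/esym/(sU k).
apply/(@negligibleP _ _ _ P) => //.
exact: (seq_event_measurable 0 mE').
Qed.

End Stationary.

(** * Outer approximation by a countable family *)

Section OuterApproximation.
Context {R : realType} {d : nat}.
Implicit Types (x y z u v : 'rV[R]_d) (r e : R) (A B K : set 'rV[R]_d).

(** The closed counterpart of [thicken]: with [0 < e], a body yields a body. *)
Definition parallel_body A e := [set x | exists2 y, A y & enorm (x - y) <= e].

Lemma parallel_body_body A e : 0 < e -> body A -> body (parallel_body A e).
Proof.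
move=> e0 [cA kA [c [r [r0 rA]]]]; split.
- move=> x x' t [y Ay xy] [y' Ay' xy'] t01; exists (t *: y + (1 - t) *: y'); first exact: cA.
  have -> : t *: x + (1 - t) *: x' - (t *: y + (1 - t) *: y') = t *: (x - y) + (1 - t) *: (x' - y').
    by apply/rowP => i; rewrite !mxE; ring.
  have := @cball_cvx R d 0 e (x - y) (x' - y') t; rewrite /cball /= !subr0.
  exact.
- have -> : parallel_body A e = (fun p => p.1 + p.2) @` (A `*` cball 0 e).
    apply/seteqP; split=> [x [y Ay xy]|_ [[y w] [/= Ay we] <-]].
      exists (y, x - y); last by rewrite /= addrC subrK.
      by split => //=; rewrite /cball /= subr0.
    by exists y => //; move: we; rewrite /cball /= subr0 [y + w]addrC addrK.
  apply: continuous_compact; last by apply: compact_setX => //; exact: cball_compact.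
  apply: continuous_subspaceT => -[y w].
  exact: (cvgD cvg_fst cvg_snd).
- exists c, r; split => // x /rA Ax; exists x => //.
  by rewrite subrr enorm0 ltW.
Qed.

Lemma support_fun_parallel A B e x : compact A -> B !=set0 -> compact B ->
  B `<=` parallel_body A e -> sphere R d x ->
  support_fun B x <= support_fun A x + e.
Proof.
move=> kA B0 kB BA x1; have [y By ->] := support_funP x B0 kB.
have [z Az yz] := BA _ By.
have := support_fun_ge x kA Az; have := dot_le (y - z) x.
rewrite (_ : enorm x = 1)// mulr1 !dotL; lra.
Qed.

(** Since [A] contains a ball of radius [r] about [c], its parallel body at distance [r * e / v]
    lies in the dilate of [A] about [c] with ratio [1 + e / v], whose volume radius is [v + e]. *)
Lemma volume_radius_parallel A : (0 < d)%N -> body A -> forall e, 0 < e ->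
  exists2 s, 0 < s & forall B, body B -> B `<=` parallel_body A s ->
    volume_radius B <= volume_radius A + e.
Proof.
move=> d0 bA e e0; have [cA kA [c [r [r0 rA]]]] := bA.
have v0 := volume_radius_gt0 d0 bA; set v := volume_radius A in v0 *.
pose s := r * e / v; have s0 : 0 < s by rewrite divr_gt0// mulr_gt0.
exists s => // B bB BA; have [_ kB _] := bB.
pose l := 1 + e / v.
have ev0 : 0 < e / v by rewrite divr_gt0.
have l0 : 0 < l by rewrite addr_gt0.
have li0 : 0 < l^-1 by rewrite invr_gt0.
have sE : s = r * (e / v) by rewrite /s mulrA.
(* The dilate of [A] about [c] with ratio [l], described through the inverse homothety. *)
pose C : set 'rV[R]_d := [set x | A (l^-1 *: x + (1 - l^-1) *: c)].
have BC : B `<=` C.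
  move=> x /BA [y Ay xy]; rewrite /C /=.
  have Az : A (c + (e / v)^-1 *: (x - y)).
    apply: rA; rewrite /cball /= [c + _]addrC addrK enormZ gtr0_norm ?invr_gt0//.
    by rewrite mulrC ler_pdivrMr// -sE.
  have l01 : 0 <= l^-1 <= 1.
    by rewrite ltW//= invf_le1// lerDl ltW.
  have := cA _ _ _ Ay Az l01; congr A.
  have -> : 1 - l^-1 = l^-1 * (e / v).
    have lN0 : l != 0 by rewrite gt_eqF.
    by rewrite -{1}(mulVf lN0) -[X in _ - X]mulr1 -mulrBr {2}/l [1 + _]addrC addrK.
  rewrite scalerDr scalerA -mulrA mulfV ?gt_eqF// mulr1.
  by apply/rowP => i; rewrite !mxE; ring.
have kC : compact C.
  have -> : C = (fun y => l *: (y - (1 - l^-1) *: c)) @` A.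
    apply/seteqP; split=> [x Cx|_ [y Ay <-]].
      exists (l^-1 *: x + (1 - l^-1) *: c) => //.
      by rewrite addrK scalerA divff ?scale1r// gt_eqF.
    by rewrite /C /= scalerA mulVf ?gt_eqF// scale1r subrK.
  apply: continuous_compact => //; apply: continuous_subspaceT => y.
  apply: (@cvgZ _ _ _ (nbhs y)); first exact: cvg_cst.
  apply: (@cvgB _ _ _ (nbhs y)); first exact: cvg_id.
  exact: cvg_cst.
have vC : vol C = l ^+ d * vol A.
  apply: EFin_inj; rewrite EFinM -!volumeE// volume_affine ?invrK//.
  exact: compact_borel.
apply: volume_radius_le => //; first by rewrite addr_ge0// ltW.
apply: le_trans (vol_le kB kC BC) _; rewrite vC vol_volume_radius// -/v mulrA.
rewrite -exprMn ler_pM2r ?kappa_gt0//.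
by rewrite (_ : l * v = v + e)// /l mulrDl mul1r divfK// gt_eqF.
Qed.

(** The approximants are chosen, not built: a body is coded by a precision [h] and a finite net of
    rational points, codes are countably many, and one body is picked for each code in use. Bodies
    with the same code are within [2 * h] of each other. *)
Lemma countable_outer_family : exists F : nat -> set 'rV[R]_d,
  (forall n, body (F n)) /\
  forall A e, body A -> 0 < e ->
    exists n, A `<=` F n /\ F n `<=` parallel_body A e.
Proof.
pose I := (seq 'rV[rat]_d * nat)%type.
pose pt (q : 'rV[rat]_d) : 'rV[R]_d := map_mx ratr q.
pose code (i : I) K := [/\ body K,
  forall x, K x -> exists2 q, q \in i.1 & enorm (x - pt q) < i.2.+1%:R^-1 &
  forall q, q \in i.1 -> exists2 x, K x & enorm (x - pt q) < i.2.+1%:R^-1].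
have /choice[f fP] (i : I) : exists K, body K /\ ((exists K, code i K) -> code i K).
  have [[K cK]|nK] := pselect (exists K, code i K).
    by exists K; split => //; case: cK.
  by exists (cball 0 1); split=> [|/nK//]; exact: body_cball.
(* Thickening by [2 * h] makes the chosen body contain every body with its code; it then exceeds
   such a body by at most [4 * h], whence [h < e / 4] below. *)
pose G (i : I) := parallel_body (f i) (2 * i.2.+1%:R^-1).
have G0 i : 0 < 2 * (i : I).2.+1%:R^-1 :> R by rewrite mulr_gt0// invr_gt0.
exists (fun n => if (choice.unpickle n : option I) is Some i then G i else cball 0 1).
split=> [n|A e bA e0].
  case: (choice.unpickle n : option I) => [i|]; last exact: body_cball.
  by apply: parallel_body_body => //; exact: (fP i).1.
have [k] : exists k, 0 + k.+1%:R^-1 < e / 4 by apply: ltr_add_invr; rewrite divr_gt0.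
rewrite add0r; set h : R := k.+1%:R^-1 => he.
have h0 : 0 < h by rewrite invr_gt0.
have [_ kA _] := bA.
pose D := [set q : 'rV[rat]_d | exists2 x, A x & enorm (x - pt q) < h].
have : A `<=` cover D (fun q => [set x | enorm (x - pt q) < h]).
  by move=> x Ax; have [q xq] := rat_dense_enorm x h0; exists q => //; exists x.
move: (kA); rewrite compact_cover => /(_ _ _ _ _) H /H{H} [].
  by move=> q _; exact: ball_open_enorm.
move=> E ED AE.
pose i : I := (enum_fset E, k).
have cA : code i A.
  split=> [//|x /AE[q /= Eq xq]|q qE]; first by exists q.
  by have := ED q qE; rewrite inE.
have [_ fi] := fP i; have {fi} [_ f1 f2] := fi (ex_intro _ A cA).
have [_ A1 A2] := cA.
exists (choice.pickle i); rewrite choice.pickleK; split=> x.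
  move=> /A1[q qE xq]; have [y fy yq] := f2 q qE; exists y => //.
  rewrite /= in xq yq *; have := enorm_distD x (pt q) y; rewrite (enormBC (pt q)).
  by rewrite -/h in xq yq *; lra.
move=> [y fy]; have [q qE yq] := f1 _ fy; have [z Az zq] := A2 q qE.
rewrite /= -/h in yq zq * => xy; exists z => //.
have := enorm_distD x y z; have := enorm_distD y (pt q) z; rewrite (enormBC (pt q)).
by lra.
Qed.

End OuterApproximation.

(** * Universality *)

Section Universality.
Context {R : realType} {d : nat}.
Variable sigma : probability (borel_rV R d) R.
Hypothesis sigma_inv : rotation_invariant sigma.
Hypothesis d0 : (0 < d)%N.
Implicit Types (A B K : set 'rV[R]_d) (b : bool) (r e : R).
Local Notation piter b := (iter_sym (@psym R d b)).
Local Notation L := (mean_radius sigma).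
Local Notation S := (sphere R d).

Lemma rounds_to_shift b (u : nat -> 'rV[R]_d) k A r :
  rounds_to (fun n => piter b (fun i => u (k + i)%N) 0 n A) r ->
  rounds_to (fun n => piter b u k n A) r.
Proof.
move=> H e e0; have [N _ HN] := H e e0.
exists (k + N)%N => // n /= kNn x x1.
have kn : (k <= n)%N by exact: leq_trans (leq_addr _ _) kNn.
by rewrite -(subnKC kn) iter_sym_shift; apply: HN => //=; rewrite leq_subRL.
Qed.

Lemma rounds_to_sub (C : nat -> set 'rV[R]_d) r e :
  (forall n, body (C n)) -> rounds_to C r -> 0 <= r -> 0 < e ->
  \forall n \near \oo, C n `<=` cball 0 (r + e).
Proof.
move=> bC H r0 e0; have := H e e0; apply: filterS => n Hn.
have [_ kC _] := bC n; apply: support_fun_le_sub => //; first by rewrite addr_ge0// ltW.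
by move=> x /Hn; rewrite ler_distl => /andP[].
Qed.

Section Directions.
Variable u : nat -> 'rV[R]_d.
Hypothesis u1 : forall i, S (u i).

Lemma vol_piter_steiner k n A : body A -> vol (piter true u k n A) = vol A.
Proof.
move=> bA; rewrite -iter_steinerE// /iter_sym.
elim: (index_iota k n) A bA => [//|i s IHs] A bA /=.
have [cA kA _] := bA; rewrite IHs; first by rewrite /vol volume_steiner.
by rewrite steiner_symE//; exact: psym_body.
Qed.

Lemma mean_radius_piter_minkowski k n A : body A -> L (piter false u k n A) = L A.
Proof.
rewrite /iter_sym; elim: (index_iota k n) A => [//|i s IHs] A bA /=.
have [_ kA _] := bA; rewrite IHs; last exact: psym_body.
by rewrite mean_radius_minkowski//; exact: body_nonempty.
Qed.

Variable F : nat -> set 'rV[R]_d.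
Hypothesis bF : forall n, body (F n).
Hypothesis outerF : forall A e, body A -> 0 < e ->
  exists n, A `<=` F n /\ F n `<=` parallel_body A e.

Lemma family_S_rounds :
  (forall j k, rounds_to (fun n => piter true (fun i => u (k + i)%N) 0 n (F j))
    (volume_radius (F j))) ->
  forall A k, body A -> rounds_to (fun n => piter true u k n A) (volume_radius A).
Proof.
move=> HF A k bA e e0; have r0 := volume_radius_gt0 d0 bA.
set r := volume_radius A in r0 *.
have [s0 s00 Hs0] := @volume_inside R d _ _ r0 e0.
(* Half of [s] pays for replacing [A] by a larger member of the family, half for the rounding of
   that member; [s <= e] serves the upper bound and [s <= s0] the lower one. *)
pose s := Num.min s0 e; have s_gt0 : 0 < s by rewrite lt_min s00.
have s2 : 0 < s / 2 by rewrite divr_gt0.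
have [t t0 Ht] := volume_radius_parallel d0 bA s2.
have [j [AF FA]] := outerF bA t0.
have rF := Ht _ (bF j) FA; rewrite -/r in rF.
have rF0 := volume_radius_gt0 d0 (bF j).
have bFn n := piter_body true k n u1 (bF j).
have := rounds_to_sub bFn (rounds_to_shift (HF j k)) (ltW rF0) s2.
apply: filterS => n Fn x x1.
have bS := piter_body true k n u1 bA; have [_ kS _] := bS.
have Ss : piter true u k n A `<=` cball 0 (r + s).
  move=> z /(piter_mono AF) /Fn; rewrite /cball /=; lra.
have ss0 : s <= s0 by rewrite ge_min lexx.
have se : s <= e by rewrite ge_min lexx orbT.
rewrite ler_distl; apply/andP; split.
  apply: (Hs0 _ bS) => //.
    by move=> z /Ss; rewrite /cball /=; lra.
  by rewrite vol_piter_steiner// vol_volume_radius.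
by have := support_fun_le_cball (body_nonempty bS) kS Ss x1; lra.
Qed.

Lemma family_M_rounds :
  (forall j k, rounds_to (fun n => piter false (fun i => u (k + i)%N) 0 n (F j))
    (L (F j))) ->
  forall A k, body A -> rounds_to (fun n => piter false u k n A) (L A).
Proof.
move=> HF A k bA e e0; have [_ kA _] := bA; have A0 := body_nonempty bA.
have r0 := mean_radius_ge0 sigma_inv A0 kA.
set r := mean_radius sigma A in r0 *.
have [s0 s00 Hs0] := mean_radius_inside sigma_inv r0 e0.
pose s := Num.min s0 e; have s_gt0 : 0 < s by rewrite lt_min s00.
have s2 : 0 < s / 2 by rewrite divr_gt0.
have [j [AF FA]] := outerF bA s2.
have [_ kF _] := bF j; have F0 := body_nonempty (bF j).
have rF : L (F j) <= r + s / 2.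
  apply: mean_radius_leD => // x x1; exact: support_fun_parallel.
have rF0 := mean_radius_ge0 sigma_inv F0 kF.
have bFn n := piter_body false k n u1 (bF j).
have := rounds_to_sub bFn (rounds_to_shift (HF j k)) rF0 s2.
apply: filterS => n Fn x x1.
have bS := piter_body false k n u1 bA; have [_ kS _] := bS.
have Ss : piter false u k n A `<=` cball 0 (r + s).
  move=> z /(piter_mono AF) /Fn; rewrite /cball /=; lra.
have ss0 : s <= s0 by rewrite ge_min lexx.
have se : s <= e by rewrite ge_min lexx orbT.
rewrite ler_distl; apply/andP; split.
  apply: (Hs0 _ bS) => //.
    by move=> z /Ss; rewrite /cball /=; lra.
  by rewrite mean_radius_piter_minkowski.
by have := support_fun_le_cball (body_nonempty bS) kS Ss x1; lra.
Qed.

(* [B_{k,n} A] contains [S_{m,n} B_{k,m} A], which tends to a ball; taking [m]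
   with [B_{k,m} A] of nearly maximal volume pins down the limit. *)
Lemma S_rounds_M_rounds :
  (forall A k, body A -> rounds_to (fun n => piter true u k n A) (volume_radius A)) ->
  forall A k, body A -> rounds_to (fun n => piter false u k n A) (L A).
Proof.
move=> HS A k bA.
have bB n := piter_body false k n u1 bA.
pose v := [set volume_radius (piter false u k n A) | n in [set n | (k <= n)%N]].
have [M M0 AM] : exists2 M, 0 < M & A `<=` cball 0 M.
  have [_ kA _] := bA; have [M M0 AM] := compact_enorm kA; exists M => // x /AM.
  by rewrite /cball /= subr0.
have vM : ubound v M.
  move=> _ [n _ <-]; apply: volume_radius_le => //; first exact: ltW.
  rewrite -(@vol_cball R d 0 M M0); apply: vol_le; [by case: (bB n)|exact: cball_compact|].
  exact: piter_sub_cball.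
have vs : has_sup v.
  by split; [exists (volume_radius (piter false u k k A)), k => /=|exists M].
(* The limit is sought as the ball of this radius; conservation of the mean radius then forces
   [r = L A]. *)
pose r := sup v.
have vr n : (k <= n)%N -> volume_radius (piter false u k n A) <= r.
  by move=> kn; apply: ub_le_sup; [exists M|exists n].
have r0 : 0 < r.
  exact: lt_le_trans (volume_radius_gt0 d0 (bB k)) (vr k (leqnn k)).
suff Hr : rounds_to (fun n => piter false u k n A) r.
  suff -> : L A = r by [].
  have [_ kA _] := bA.
  apply/eqP; rewrite eq_le; apply/andP; split; apply/ler_addgt0Pr => e e0;
    have [N _ HN] := Hr e e0; have {}HN := HN N (leqnn N);
    have [_ kB _] := bB N; rewrite -(mean_radius_piter_minkowski k N bA).
    apply: mean_radius_le => // [|x /HN]; first exact: body_nonempty.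
    by rewrite ler_distl => /andP[].
  rewrite -lerBlDr; apply: mean_radius_ge => // [|x /HN]; first exact: body_nonempty.
  by rewrite ler_distl => /andP[].
move=> e e0; have [s0 s00 Hs0] := @volume_outside R d _ _ r0 e0.
pose s := Num.min s0 e; have s_gt0 : 0 < s by rewrite lt_min s00.
have ss0 : s <= s0 by rewrite ge_min lexx.
have se : s <= e by rewrite ge_min lexx orbT.
have s2 : 0 < s / 2 by rewrite divr_gt0.
have [_ [m /= km <-] vm] := sup_adherent s2 vs.
rewrite -/r in vm.
have [N _ HN] := HS _ m (bB m) _ s2.
exists (maxn m N) => // n /=; rewrite geq_max => /andP[mn Nn].
have {}HN := HN n Nn; have kn := leq_trans km mn.
have [_ kBn _] := bB n; have Bn0 := body_nonempty (bB n).
have bSn := piter_body true m n u1 (bB m); have [_ kSn _] := bSn.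
have low x : S x -> r - s <= support_fun (piter false u k n A) x.
  move=> x1; have := HN x x1; rewrite ler_distl => /andP[H _].
  rewrite (iter_sym_split _ u A km mn).
  apply: (@le_trans _ _ (support_fun (piter true u m n (piter false u k m A)) x)).
    by lra.
  apply: support_fun_mono => //; first exact: body_nonempty.
    by rewrite -iter_sym_split.
  exact: piter_steiner_minkowski.
move=> x x1; rewrite ler_distl; apply/andP; split.
  by have := low x x1; lra.
(* The supremum caps the volume of the iterate, which contains the ball of radius [r - s]: there is
   no room left for a protrusion. *)
apply: (Hs0 _ (bB n)) => //.
  have [cBn _ _] := bB n.
  apply: cball_sub_support => // y y1; have := low y y1; lra.
rewrite vol_volume_radius// ler_pM2r ?kappa_gt0//.
by rewrite ler_pXn2r ?nnegrE ?vr// ltW// volume_radius_gt0.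
Qed.

(* Dually, [S_{k,n} A] is contained in [B_{m,n} S_{k,m} A], where [m] is such
   that [S_{k,m} A] has nearly minimal mean radius. *)
Lemma M_rounds_S_rounds :
  (forall A k, body A -> rounds_to (fun n => piter false u k n A) (L A)) ->
  forall A k, body A -> rounds_to (fun n => piter true u k n A) (volume_radius A).
Proof.
move=> HM A k bA.
have bB n := piter_body true k n u1 bA.
have L0 n : 0 <= L (piter true u k n A).
  by apply: mean_radius_ge0 => //; [exact: body_nonempty|case: (bB n)].
pose v := [set L (piter true u k n A) | n in [set n | (k <= n)%N]].
have vi : has_inf v.
  by split; [exists (L (piter true u k k A)), k => /=|exists 0 => _ [n _ <-]].
(* Once the iterates are known to tend to the ball of this radius, conservation of volume forces
   [r = volume_radius A]. *)
pose r := inf v.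
have vr n : (k <= n)%N -> r <= L (piter true u k n A).
  by move=> kn; apply: ge_inf; [case: vi|exists n].
have r0 : 0 <= r.
  by apply: lb_le_inf => [|_ [n _ <-]//]; case: vi.
have Hr : rounds_to (fun n => piter true u k n A) r.
  move=> e e0; have [s0 s00 Hs0] := mean_radius_inside sigma_inv r0 e0.
  pose s := Num.min s0 e; have s_gt0 : 0 < s by rewrite lt_min s00.
  have ss0 : s <= s0 by rewrite ge_min lexx.
  have se : s <= e by rewrite ge_min lexx orbT.
  have s2 : 0 < s / 2 by rewrite divr_gt0.
  have [_ [m /= km <-] vm] := inf_adherent s2 vi.
  rewrite -/r in vm.
  have bBn n := piter_body false m n u1 (bB m).
  have [N _ HN] := rounds_to_sub bBn (HM _ m (bB m)) (L0 m) s2.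
  exists (maxn m N) => // n /=; rewrite geq_max => /andP[mn Nn] x x1.
  have {}HN := HN n Nn; have kn := leq_trans km mn.
  have [_ kSn _] := bB n.
  have Ss : piter true u k n A `<=` cball 0 (r + s).
    move=> z; rewrite (iter_sym_split _ u A km mn).
    move=> /piter_steiner_minkowski /HN; rewrite /cball /=; lra.
  rewrite ler_distl; apply/andP; split.
    (* The infimum bounds the mean radius of every iterate from below, which forbids a dip inside
       the enlarged ball. *)
    apply: (Hs0 _ (bB n)) => //; last exact: vr.
    by move=> z /Ss; rewrite /cball /=; lra.
  by have := support_fun_le_cball (body_nonempty (bB n)) kSn Ss x1; lra.
suff -> : volume_radius A = r by [].
have [_ kA _] := bA; have va0 := volume_radius_gt0 d0 bA.
apply/eqP; rewrite eq_le; apply/andP; split; apply/ler_addgt0Pr => e e0;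
  have [N _ HN] := Hr e e0; have {}HN := HN N (leqnn N); have [cB kB _] := bB N.
  have re0 : 0 < r + e by exact: ltr_wpDl.
  apply: volume_radius_le => //; first exact: ltW.
  rewrite -(vol_piter_steiner k N bA) -(@vol_cball R d 0 _ re0).
  apply: vol_le => //; first exact: cball_compact.
  apply: support_fun_le_sub => //; first exact: ltW.
  by move=> x /HN; rewrite ler_distl => /andP[].
rewrite -lerBlDr; have [re|re] := leP (r - e) 0; first by rewrite (le_trans re)// ltW.
apply: volume_radius_ge => //; first exact: ltW.
rewrite -(vol_piter_steiner k N bA) -(@vol_cball R d 0 _ re).
apply: vol_le => //; first exact: cball_compact.
apply: cball_sub_support => //; first exact: body_nonempty.
by move=> x /HN; rewrite ler_distl => /andP[].
Qed.

Lemma rounds_universal :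
  (forall A k, body A -> rounds_to (fun n => piter true u k n A) (volume_radius A)) ->
  (forall A k, body A -> rounds_to (fun n => piter false u k n A) (L A)) ->
  universal sigma u.
Proof.
move=> HS HM; split=> A k /convex_bodyP bA; have [_ kA _] := bA.
  rewrite (_ : (fun n => _) = fun n => piter true u k n A); last first.
    by apply/funext => n; exact: iter_steinerE.
  apply/hausdorff_cvgP; [|by move=> n; exact: piter_body|exact: HS].
  by rewrite ltW// volume_radius_gt0.
rewrite (_ : (fun n => _) = fun n => piter false u k n A); last first.
  by apply/funext => n; exact: iter_minkowskiE.
apply/hausdorff_cvgP; [|by move=> n; exact: piter_body|exact: HM].
by apply: mean_radius_ge0 => //; exact: body_nonempty.
Qed.

End Directions.

Lemma S_roundsP u A : (forall i, S (u i)) -> body A ->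
  S_rounds u A <-> round_event true A (volume_radius A) u.
Proof.
move=> u1 bA; have r0 := ltW (volume_radius_gt0 d0 bA).
rewrite round_eventP// -hausdorff_cvgP//; last by move=> n; exact: piter_body.
rewrite /S_rounds (_ : (fun n => _) = fun n => piter true u 0 n A)//.
by apply/funext => n; exact: iter_steinerE.
Qed.

Lemma M_roundsP u A : (forall i, S (u i)) -> body A ->
  M_rounds sigma u A <-> round_event false A (L A) u.
Proof.
move=> u1 bA; have [_ kA _] := bA.
have r0 := mean_radius_ge0 sigma_inv (body_nonempty bA) kA.
rewrite round_eventP// -hausdorff_cvgP//; last by move=> n; exact: piter_body.
rewrite /M_rounds (_ : (fun n => _) = fun n => piter false u 0 n A)//.
by apply/funext => n; exact: iter_minkowskiE.
Qed.

End Universality.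

(** The pairs [(j, k)] are countably many, so a single null set serves all of them. *)
Lemma ae_rounds_shifts (R : realType) (d : nat) (disp : measure_display)
    (Omega : measurableType disp) (P : probability Omega R)
    (U : nat -> {RV P >-> borel_rV R d}) (U_stationary : stationary U) b
    (F : nat -> set 'rV[R]_d) (r : nat -> R) : (forall j, compact (F j)) ->
  (forall j, {ae P, forall w, round_event b (F j) (r j) (fun n => U n w)}) ->
  {ae P, forall w, forall j k, round_event b (F j) (r j) (fun n => U (k + n)%N w)}.
Proof.
move=> kF H; apply: ae_foralln => j; apply: ae_foralln => k.
apply: stationary_ae => //; exact: round_event_measurable.
Qed.

Unset Implicit Arguments.

Theorem proposition1 (R : realType) (d : nat) (d_gt0 : (0 < d)%N)
    (sigma : probability (borel_rV R d) R)
    (sigma_inv : rotation_invariant sigma)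
    (disp : measure_display) (Omega : measurableType disp)
    (P : probability Omega R)
    (U : nat -> {RV P >-> borel_rV R d})
    (U_sphere : forall n w, sphere R d (U n w))
    (U_stationary : stationary U) :
  ((forall A : set 'rV[R]_d, convex_body A ->
      {ae P, forall w, S_rounds (fun n => U n w) A}) ->
   {ae P, forall w, universal sigma (fun n => U n w)})
  /\
  ((forall A : set 'rV[R]_d, convex_body A ->
      {ae P, forall w, M_rounds sigma (fun n => U n w) A}) ->
   {ae P, forall w, universal sigma (fun n => U n w)}).
Proof.
have [F [bF outerF]] := @countable_outer_family R d.
have kF j : compact (F j) by case: (bF j).
split=> H.
- have : {ae P, forall w, forall j k,
      round_event true (F j) (volume_radius (F j)) (fun n => U (k + n)%N w)}.
    apply: ae_rounds_shifts => // j.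
    have := H (F j) (iffRL (convex_bodyP (F j)) (bF j)); apply: filterS => w.
    by move/S_roundsP; apply.
  apply: filterS => w Hw.
  (* From here on the outcome [w] is fixed and the argument is deterministic. *)
  have HS := family_S_rounds d_gt0 (fun n => U_sphere n w) bF outerF.
  have {}HS := HS (fun j k => iffLR (round_eventP _ (fun n => U_sphere (k + n)%N w) (bF j)
    (ltW (volume_radius_gt0 d_gt0 (bF j)))) (Hw j k)).
  exact: (rounds_universal sigma_inv d_gt0 (fun n => U_sphere n w) HS
    (S_rounds_M_rounds sigma_inv d_gt0 (fun n => U_sphere n w) HS)).
- have L0 j : 0 <= mean_radius sigma (F j).
    by apply: mean_radius_ge0 => //; exact: body_nonempty.
  have : {ae P, forall w, forall j k,
      round_event false (F j) (mean_radius sigma (F j)) (fun n => U (k + n)%N w)}.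
    apply: ae_rounds_shifts => // j.
    have := H (F j) (iffRL (convex_bodyP (F j)) (bF j)); apply: filterS => w.
    by move/M_roundsP; apply.
  apply: filterS => w Hw.
  have HM := family_M_rounds sigma_inv (fun n => U_sphere n w) bF outerF.
  have {}HM := HM (fun j k => iffLR (round_eventP _ (fun n => U_sphere (k + n)%N w) (bF j)
    (L0 j)) (Hw j k)).
  exact: (rounds_universal sigma_inv d_gt0 (fun n => U_sphere n w)
    (M_rounds_S_rounds sigma_inv d_gt0 (fun n => U_sphere n w) HM) HM).
Qed.
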